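(* Let $n\ge 2$, let $1\le \iota\le n-1$, and put $I=\{\iota\}$. Then $$\Xi_{n,I}(s_0,s_\iota)=\frac{q^{-\iota s_\iota}}{1-q^{-s_0n}q^{-\iota s_\iota}q^{\iota(n-\iota)}}\left(\binom{n}{\iota}_q\frac{q^{-s_0n}}{1-q^{-s_0n}}+\theta_{n,\iota}\frac{1}{1-q^{-\iota s_\iota}}\right),$$ where $\theta_{n,\iota}$ is the coefficient of $z^\iota$ in the power series expansion of $\prod_{i=1}^{n-\iota+1}\frac{1}{1-iz}$.
   Context: $\mathfrak{o}$ is a compact discrete valuation ring with uniformizer $\pi$ and residue field of cardinality $q$. The $\mathfrak{o}$-module $\mathfrak{o}^n$ carries componentwise multiplication; $\Lambda\le_s\mathfrak{o}^n$ means that $\Lambda$ is a finite-index $\mathfrak{o}$-submodule of $\mathfrak{o}^n$ closed under multiplication (not required to contain $(1,\dots,1)$). For $1\le\iota\le n-1$, $r_0\in\mathbb{Z}_{\ge0}$ and $r\in\mathbb{Z}_{\ge1}$, let $h_n(\{\iota\},r_0,r)$ be the number of $\Lambda\le_s\mathfrak{o}^n$ with $\mathfrak{o}^n/\Lambda\cong(\mathfrak{o}/\pi^{r_0+r}\mathfrak{o})^{\iota}\oplus(\mathfrak{o}/\pi^{r_0}\mathfrak{o})^{n-\iota}$. Define $$\Xi_{n,\{\iota\}}(s_0,s_\iota)=\sum_{r_0\ge0}\sum_{r\ge1}h_n(\{\iota\},r_0,r)\,q^{-s_0nr_0-r\iota s_\iota}.$$ The identity is to be read as an identity of formal power series in $q^{-ns_0}$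 and $q^{-\iota s_\iota}$ (equivalently, for $\operatorname{Re}(s_0),\operatorname{Re}(s_\iota)$ sufficiently large). $\binom{n}{r}_q=\prod_{i=0}^{r-1}\frac{1-q^{n-i}}{1-q^{r-i}}$ is the Gaussian binomial. *)

(* Defs.v *)
From HB Require Import structures.
From mathcomp Require Import all_boot all_order all_algebra.
From mathcomp Require Import finmap.
From mathcomp Require Import boolp classical_sets functions cardinality filter
  topology.

Set Implicit Arguments.
Unset Strict Implicit.
Unset Printing Implicit Defensive.

Import GRing.Theory.
Local Open Scope classical_set_scope.
Local Open Scope ring_scope.

Section QuotientModule.
Variables (R : pzRingType) (V : lmodType R) (M : submodClosed V).

Fact submod_oppr_closed : oppr_closed M.
Proof. by move=> x Mx; rewrite -scaleN1r rpredZ. Qed.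

Definition submod_zmodClosed : zmodClosed V :=
  HB.pack (GRing.SubmodClosed.sort M)
    (GRing.isOppClosed.Build V (GRing.SubmodClosed.sort M) submod_oppr_closed).

Definition quotmod := Quotient.quot submod_zmodClosed.

HB.instance Definition _ := GRing.Zmodule.on quotmod.
HB.instance Definition _ := EqQuotient.on quotmod.

Local Notation pi_q := (\pi_quotmod%qT).

Definition quotmod_scale (a : R) (x : quotmod) : quotmod := pi_q (a *: repr x).

Fact quotmod_eqP (x y : V) : reflect (pi_q x = pi_q y) (x - y \in M).
Proof.
apply: (iffP idP) => [xyM|/eqP].
  by apply/eqP; rewrite -(Quotient.idealrBE submod_zmodClosed).
by rewrite -(Quotient.idealrBE submod_zmodClosed).
Qed.

Fact quotmod_scale_pi a x : quotmod_scale a (pi_q x) = pi_q (a *: x).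
Proof.
apply/quotmod_eqP; rewrite -scalerBr rpredZ //.
by apply/quotmod_eqP; rewrite reprK.
Qed.

Fact quotmod_piD x y : pi_q (x + y) = pi_q x + pi_q y.
Proof. exact: (@Quotient.pi_add V submod_zmodClosed x y). Qed.

Fact quotmod_scaleA a b x :
  quotmod_scale a (quotmod_scale b x) = quotmod_scale (a * b) x.
Proof. by rewrite !quotmod_scale_pi scalerA. Qed.

Fact quotmod_scale1 : left_id 1 quotmod_scale.
Proof. by move=> x; rewrite /quotmod_scale scale1r reprK. Qed.

Fact quotmod_scaleDr : right_distributive quotmod_scale +%R.
Proof.
move=> a x y; rewrite -[x]reprK -[y]reprK -quotmod_piD.
by rewrite !(quotmod_scale_pi a) scalerDr quotmod_piD.
Qed.

Fact quotmod_scaleDl x : {morph quotmod_scale^~ x : a b / a + b}.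
Proof.
by move=> a b; rewrite /quotmod_scale scalerDl quotmod_piD.
Qed.

HB.instance Definition _ := GRing.Zmodule_isLmodule.Build R quotmod
  quotmod_scaleA quotmod_scale1 quotmod_scaleDr quotmod_scaleDl.

End QuotientModule.

Definition lmod_isomorphic (R : pzRingType) (U V : lmodType R) : Prop :=
  exists f : {linear U -> V}, bijective f.

(* Ideals of a commutative ring [R] are the submodules of the module [R^o]. *)
Section Principal.
Variables (R : comNzRingType) (a : R).

Definition principal : {pred R^o} := [pred x | `[< exists b : R, x = b * a >]].

Fact principal_submod_closed : subsemimod_closed principal.
Proof.
split; first split.
- by apply/asboolP; exists 0; rewrite mul0r.
- move=> x y /asboolP[b ->] /asboolP[c ->]; apply/asboolP; exists (b + c).
  by rewrite mulrDl.
- by move=> c x /asboolP[b ->]; apply/asboolP; exists (c * b); rewrite -mulrA.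
Qed.

HB.instance Definition _ :=
  GRing.isSubSemiModClosed.Build R R^o principal principal_submod_closed.

Definition principal_ideal : submodClosed R^o := principal.

End Principal.

Definition maximal_ideal (R : comNzRingType) (M : submodClosed R^o) : Prop :=
  1 \notin M /\
  forall J : submodClosed R^o, {subset M <= J} -> 1 \notin J -> J =i M.

Record is_dvr (R : idomainType) : Prop := {
  dvr_principal : forall I : submodClosed R^o,
    exists a : R, I =i principal_ideal a ;
  dvr_local : exists M : submodClosed R^o, maximal_ideal M /\
    forall N : submodClosed R^o, maximal_ideal N -> N =i M ;
  dvr_nonfield : exists x : R, x != 0 /\ x \isn't a GRing.unit }.

Definition uniformizer (R : idomainType) (p : R) : Prop :=
  maximal_ideal (principal_ideal p).

(* [R] with the [p]-adic topology. *)
Definition adic (R : comNzRingType) (p : R) : Type := R.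

Section AdicTopology.
Variables (R : comNzRingType) (p : R).

HB.instance Definition _ := Choice.copy (adic p) R.

Definition adic_open (U : set (adic p)) : Prop :=
  forall x : R, U x -> exists k : nat, forall y : R, U (x + y * p ^+ k).

Fact adic_openT : adic_open setT.
Proof. by move=> x _; exists 0%N. Qed.

Fact adic_openI : setI_closed adic_open.
Proof.
move=> A B oA oB x [/oA[k Ak] /oB[l Bl]]; exists (k + l)%N => y; split.
  by rewrite exprD mulrC -mulrA mulrC [_ * y]mulrC.
by rewrite exprD mulrA.
Qed.

Fact adic_open_bigU (I : Type) (f : I -> set (adic p)) :
  (forall i, adic_open (f i)) -> adic_open (\bigcup_i f i).
Proof.
by move=> of_ x [i _ /of_[k fik]]; exists k => y; exists i.
Qed.

HB.instance Definition _ :=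
  isOpenTopological.Build (adic p) adic_openT adic_openI adic_open_bigU.

End AdicTopology.

Definition compact_dvr (R : idomainType) (p : R) : Prop :=
  [/\ is_dvr R, uniformizer p & compact [set: adic p]].

(* 0 if [A] is infinite. *)
Definition ncard (T : Type) (A : set T) : nat :=
  #|` fset_set (A : set {classic T})|.

(* The factor [R^o] makes this a module over [R]; its ring product is
   componentwise. *)
Notation free_mod R n := {ffun 'I_n -> R^o}.

Definition multiplicative_sublattice (R : idomainType) (n : nat)
    (L : submodClosed (free_mod R n)) : Prop :=
  finite_set [set: quotmod L] /\ {in L &, forall x y, x * y \in L}.

(* (R / p^(r0+r) R)^i (+) (R / p^r0 R)^(n-i) *)
Definition elementary_type (R : idomainType) (p : R) (n i r0 r : nat)
    : lmodType R :=
  ({ffun 'I_i -> quotmod (principal_ideal (p ^+ (r0 + r)))} *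
   {ffun 'I_(n - i) -> quotmod (principal_ideal (p ^+ r0))})%type.

Definition h_count (R : idomainType) (p : R) (n i r0 r : nat) : nat :=
  ncard [set L : submodClosed (free_mod R n) |
    multiplicative_sublattice L /\
    lmod_isomorphic (quotmod L) (elementary_type p n i r0 r)].

Record fps (R : Type) : Type := Fps { fps_coef : nat -> R }.

Section FpsRing.
Variable R : comNzRingType.
Implicit Types f g : fps R.

Fact fps_coefK : cancel (@fps_coef R) (@Fps R). Proof. by case. Qed.

HB.instance Definition _ := Choice.copy (fps R) (can_type fps_coefK).

Definition fps_zero : fps R := Fps (fun=> 0).
Definition fps_opp f : fps R := Fps (fun n => - fps_coef f n).
Definition fps_add f g : fps R := Fps (fun n => fps_coef f n + fps_coef g n).
Definition fpsC (c : R) : fps R := Fps (fun n => if n is 0 then c else 0).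
Definition fpsX : fps R := Fps (fun n => (n == 1%N)%:R).
Definition fps_mul f g : fps R :=
  Fps (fun n => \sum_(i < n.+1) fps_coef f i * fps_coef g (n - i)).

Fact fpsP f g : fps_coef f =1 fps_coef g -> f = g.
Proof. by case: f g => [f] [g] /= /funext ->. Qed.

Fact fps_addA : associative fps_add.
Proof. by move=> f g k; apply: fpsP => n /=; rewrite addrA. Qed.
Fact fps_addC : commutative fps_add.
Proof. by move=> f g; apply: fpsP => n /=; rewrite addrC. Qed.
Fact fps_add0 : left_id fps_zero fps_add.
Proof. by move=> f; apply: fpsP => n /=; rewrite add0r. Qed.
Fact fps_addN : left_inverse fps_zero fps_opp fps_add.
Proof. by move=> f; apply: fpsP => n /=; rewrite addNr. Qed.

HB.instance Definition _ :=
  GRing.isZmodule.Build (fps R) fps_addA fps_addC fps_add0 fps_addN.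

Definition fps_trunc (N : nat) f : {poly R} := \poly_(i < N.+1) fps_coef f i.

Fact coef_fps_trunc N f n : (n <= N)%N -> (fps_trunc N f)`_n = fps_coef f n.
Proof. by move=> nN; rewrite coef_poly ltnS nN. Qed.

Fact fps_coefM N f g n : (n <= N)%N ->
  fps_coef (fps_mul f g) n = (fps_trunc N f * fps_trunc N g)`_n.
Proof.
move=> nN; rewrite coefM /=; apply: eq_bigr => i _.
have iN : (i <= N)%N by rewrite (leq_trans _ nN) // -ltnS.
by rewrite !coef_fps_trunc // (leq_trans (leq_subr _ _)).
Qed.

Fact fps_mulC : commutative fps_mul.
Proof. by move=> f g; apply: fpsP => n; rewrite !(@fps_coefM n) // mulrC. Qed.

Fact fps_mulA : associative fps_mul.
Proof.
move=> f g k; apply: fpsP => n.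
transitivity (fps_trunc n f * (fps_trunc n g * fps_trunc n k))`_n.
  rewrite [RHS]coefM [LHS]/=; apply: eq_bigr => i _.
  have iN : (i <= n)%N by rewrite -ltnS.
  by rewrite coef_fps_trunc // -(@fps_coefM n) ?leq_subr.
rewrite mulrA [LHS]coefM; symmetry; rewrite [LHS]/=; apply: eq_bigr => i _.
have iN : (i <= n)%N by rewrite -ltnS.
by rewrite coef_fps_trunc ?leq_subr // -(@fps_coefM n).
Qed.

Fact fps_mul1 : left_id (fpsC 1) fps_mul.
Proof.
move=> f; apply: fpsP => n /=; rewrite big_ord_recl /= mul1r subn0.
by rewrite big1 ?addr0 // => i _; rewrite mul0r.
Qed.

Fact fps_mulDl : left_distributive fps_mul fps_add.
Proof.
move=> f g k; apply: fpsP => n /=; rewrite -big_split /=.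
by apply: eq_bigr => i _; rewrite mulrDl.
Qed.

Fact fps_oner_neq0 : fpsC 1 != 0.
Proof.
by apply/eqP => /(congr1 (fun f => fps_coef f 0)) /= /eqP; rewrite oner_eq0.
Qed.

HB.instance Definition _ := GRing.Zmodule_isComNzRing.Build (fps R)
  fps_mulA fps_mulC fps_mul1 fps_mulDl fps_oner_neq0.

Definition fps_unit : pred (fps R) := [pred f | `[< exists g, g * f = 1 >]].

Definition fps_inv f : fps R :=
  if pselect (exists g, g * f = 1) is left e then projT1 (cid e) else f.

Fact fps_mulVr : {in fps_unit, left_inverse 1 fps_inv *%R}.
Proof.
move=> f /asboolP e; rewrite /fps_inv; case: pselect => // e'.
by case: (cid e').
Qed.

Fact fps_unitP f g : g * f = 1 -> fps_unit f.
Proof. by move=> gf; apply/asboolP; exists g. Qed.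

Fact fps_inv_out : {in [predC fps_unit], fps_inv =1 id}.
Proof.
move=> f; rewrite inE /= => /asboolP e; rewrite /fps_inv.
by case: pselect => // e'.
Qed.

HB.instance Definition _ := GRing.ComNzRing_hasMulInverse.Build (fps R)
  fps_mulVr fps_unitP fps_inv_out.

End FpsRing.

(* Q[[X, Y]] as Q[[Y]][[X]]: the coefficient of [X^a Y^b] in [f] is
   [fps_coef (fps_coef f a) b]. *)
Notation fps2 := (fps (fps rat)).
Definition varX : fps2 := fpsX (fps rat).
Definition varY : fps2 := fpsC (fpsX rat).
Definition fps2C (c : rat) : fps2 := fpsC (fpsC c).

(* [X] stands for q^(-n s_0) and [Y] for q^(-i s_i), so that
   q^(-s_0 n r0 - r i s_i) = X^r0 Y^r. *)
Definition Xi (R : idomainType) (p : R) (n i : nat) : fps2 :=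
  Fps (fun r0 => Fps (fun r => if (0 < r)%N then (h_count p n i r0 r)%:R else 0)).

Definition gauss_binomial (q n r : nat) : rat :=
  \prod_(0 <= i < r) ((1 - q%:R ^+ (n - i)) / (1 - q%:R ^+ (r - i))).

Definition theta (n i : nat) : rat :=
  fps_coef (\prod_(1 <= j < (n - i + 1).+1) (1 / (1 - j%:R * fpsX rat))) i.

(* Main.v *)
(* Proof idea. A submodule of the prescribed type is p^r0 M with
   M = {x | x A = 0 mod p^r} for an n x iota matrix A of full rank over the
   residue field, and p^r0 M is multiplicatively closed iff the reduction of M
   modulo p^(r - r0) (truncated subtraction) is. Lifting M from precision r >= 1
   to precision r + 1 can be done in exactly q^(iota (n - iota)) ways: perturb A
   by p^r D W, where D completes A to an invertible matrix modulo p. So it is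
   enough to count at the lowest precision. If r0 >= r there is no closure
   condition and one counts subspaces of F_q^n by full-rank matrices modulo GL.
   If r0 < r one counts closed M modulo p^m, m = r - r0; lifting idempotents,
   M is spanned by 0/1 vectors, so it is given by a partition of {0, ..., n}
   into n - iota + 1 blocks, the coordinates in the block of 0 being zero. These
   are counted by the Stirling numbers S(n + 1, n - iota + 1), whose recurrence
   is that of the complete symmetric polynomials h_iota(1, ..., n - iota + 1). *)
From HB Require Import structures.
Require Import Defs.
From mathcomp Require Import all_boot all_order all_algebra.
From mathcomp Require Import boolp classical_sets functions cardinality filter
  topology.
From mathcomp Require Import zify.

Set Implicit Arguments.
Unset Strict Implicit.
Unset Printing Implicit Defensive.
Import GRing.Theory Num.Theory.
Local Open Scope classical_set_scope.
Local Open Scope ring_scope.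

(** * Formal power series *)

Section PowerSeries.
Variable R : comNzRingType.
Implicit Types (f g : fps R) (c : R).

Lemma fps_coefE f g n :
  fps_coef (f * g) n = \sum_(i < n.+1) fps_coef f i * fps_coef g (n - i).
Proof. by []. Qed.

Lemma fps_coefD f g n : fps_coef (f + g) n = fps_coef f n + fps_coef g n.
Proof. by []. Qed.

Lemma fps_coefN f n : fps_coef (- f) n = - fps_coef f n.
Proof. by []. Qed.

Lemma fps_coef_sum (I : Type) (s : seq I) (f_ : I -> fps R) n :
  fps_coef (\sum_(i <- s) f_ i) n = \sum_(i <- s) fps_coef (f_ i) n.
Proof.
elim: s => [|i s IHs]; first by rewrite !big_nil.
by rewrite !big_cons fps_coefD IHs.
Qed.

Lemma fps_coefCM c f n : fps_coef (fpsC c * f) n = c * fps_coef f n.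
Proof.
rewrite fps_coefE big_ord_recl /= subn0 big1 ?addr0 // => i _.
by rewrite mul0r.
Qed.

Lemma fps_coef1 n : fps_coef (1 : fps R) n = (n == 0%N)%:R.
Proof. by case: n. Qed.

Lemma fps_coefXM f n :
  fps_coef (fpsX R * f) n = if n is m.+1 then fps_coef f m else 0.
Proof.
rewrite fps_coefE; case: n => [|n]; first by rewrite big_ord1 /= mul0r.
rewrite big_ord_recl /= mul0r add0r big_ord_recl /= mul1r subSS subn0.
by rewrite big1 ?addr0 // => i _; rewrite mul0r.
Qed.

Lemma fpsCM c d : fpsC (c * d) = fpsC c * fpsC d.
Proof.
by apply: fpsP => n; rewrite fps_coefCM; case: n => //= n; rewrite mulr0.
Qed.

Lemma fpsCD c d : fpsC (c + d) = fpsC c + fpsC d.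
Proof. by apply: fpsP => -[|n] //; rewrite fps_coefD /= addr0. Qed.

Lemma fpsC1 : fpsC (1 : R) = 1. Proof. by []. Qed.

Lemma fpsCN c : fpsC (- c) = - fpsC c.
Proof. by apply: fpsP => -[|n] //=; rewrite oppr0. Qed.

Lemma fpsC_nat k : fpsC (k%:R : R) = k%:R.
Proof.
elim: k => [|k IHk]; last by rewrite !mulrS fpsCD IHk.
by apply: fpsP; case.
Qed.

Lemma fps_geom_unit c : 1 - fpsX R * fpsC c \is a GRing.unit.
Proof.
apply/asboolP; exists (Fps (fun k => c ^+ k)).
apply: fpsP => n; rewrite mulrC mulrBl mul1r -mulrA fps_coefD fps_coefN.
rewrite fps_coef1 fps_coefXM; case: n => [|n]; first by rewrite subr0.
by rewrite fps_coefCM /= -exprS subrr.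
Qed.

(** Inverses of series are picked by choice, so the coefficients are read off from [f * f^-1 = 1],
    which becomes the recurrence [rec]. *)
Lemma fps_geomV c n : fps_coef (1 - fpsX R * fpsC c)^-1 n = c ^+ n.
Proof.
have e := divrr (fps_geom_unit c).
have rec m : fps_coef (1 - fpsX R * fpsC c)^-1 m =
    (m == 0%N)%:R + (if m is k.+1 then
                       c * fps_coef (1 - fpsX R * fpsC c)^-1 k else 0).
  have /(congr1 (fun f => fps_coef f m)) := e.
  rewrite mulrBl mul1r fps_coefD fps_coef1 fps_coefN -mulrA fps_coefXM => <-.
  by case: m => [|m]; rewrite ?oppr0 ?addr0 // fps_coefCM subrK.
elim: n => [|n IHn]; rewrite rec ?addr0 //.
by rewrite IHn add0r exprS.
Qed.

Lemma fpsC_inv (c d : R) : d * c = 1 -> (fpsC c)^-1 = fpsC d.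
Proof.
move=> dc; have dcC : fpsC d * fpsC c = 1 by rewrite -fpsCM dc.
have uc : fpsC c \is a GRing.unit by apply/asboolP; exists (fpsC d).
by apply: (mulIr uc); rewrite mulVr.
Qed.

Lemma fps_coefXCexpM c i f n :
  fps_coef ((fpsX R * fpsC c) ^+ i * f) n =
  if (i <= n)%N then c ^+ i * fps_coef f (n - i) else 0.
Proof.
elim: i f n => [|i IHi] f n; first by rewrite expr0 !mul1r subn0.
rewrite exprS -!mulrA fps_coefXM; case: n => [//|n].
rewrite fps_coefCM IHi ltnS subSS; case: ifP; rewrite ?mulr0 // => _.
by rewrite mulrA -exprS.
Qed.

End PowerSeries.

(** Expanding in [X] first, [1 / (1 - X Y Q)] contributes [(Y Q)^i] in degree [i], while the bracket
    [Z] has coefficient [t / (1 - Y)] in degree 0 and [g] in every positive degree. For [b = c.+1] a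
    single term survives: [i = a] if [a <= c], and [i = c] otherwise. *)
Lemma fps2_coefE (Q g t : rat) (a b : nat) :
  fps_coef (fps_coef (varY / (1 - varX * varY * fps2C Q) *
    (fps2C g * (varX / (1 - varX)) + fps2C t * (1 / (1 - varY)))) a) b =
  if b is c.+1 then (if (a <= c)%N then t * Q ^+ a else g * Q ^+ c) else 0.
Proof.
have e1 : 1 - varX * varY * fps2C Q =
    1 - fpsX (fps rat) * fpsC (fpsX rat * fpsC Q).
  by rewrite fpsCM mulrA.
have e2 : 1 - varX = 1 - fpsX (fps rat) * fpsC 1 by rewrite fpsC1 mulr1.
have e3 : (1 - varY)^-1 = fpsC (1 - fpsX rat * fpsC 1)^-1.
  rewrite -(@fpsC_inv _ (1 - fpsX rat * fpsC 1)) ?mulVr ?fps_geom_unit //.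
  by rewrite fpsC1 mulr1 fpsCD fpsCN.
rewrite e1 e2 e3 mul1r -mulrA fps_coefCM fps_coefXM.
case: b => [//|c]; rewrite fps_coefE.
rewrite /fps2C; set Z := fpsC (fpsC g) * _ + _.
have Z0 : fps_coef Z 0 = fpsC t * (1 - fpsX rat * fpsC 1)^-1.
  by rewrite fps_coefD !fps_coefCM fps_coefXM mulr0 add0r.
have ZS m : fps_coef Z m.+1 = fpsC g.
  rewrite fps_coefD !fps_coefCM fps_coefXM fps_geomV expr1n mulr1.
  by rewrite /= mulr0 addr0.
rewrite -(big_mkord xpredT (fun i => fps_coef _ i * fps_coef Z (a - i))).
rewrite big_nat_recr // subnn Z0 fps_geomV big_mkord.
rewrite (eq_bigr (fun i : 'I_a => (fpsX rat * fpsC Q) ^+ i * fpsC g)); last first.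
  by move=> i _; rewrite fps_geomV -[(a - i)%N]prednK ?subn_gt0 // ZS.
rewrite fps_coefD fps_coefXCexpM fps_coefCM fps_geomV expr1n mulr1.
rewrite fps_coef_sum (eq_bigr (fun i : 'I_a =>
    if (i == c :> nat) then Q ^+ c * g else 0)); last first.
  move=> i _; rewrite fps_coefXCexpM; case: ltngtP => [ic|//|<-]; last first.
    by rewrite subnn.
  by rewrite -[(c - i)%N]prednK ?subn_gt0 //= mulr0.
have [ac|ca] := leqP a c.
  rewrite big1 ?add0r 1?mulrC // => i _; rewrite ifN // neq_ltn.
  by rewrite (leq_trans _ ac).
rewrite addr0 (bigD1 (Ordinal ca)) //= eqxx big1 ?addr0 1?mulrC // => i.
by rewrite -val_eqE /= => /negPf ->.
Qed.

(* [complete_sym k i] is the complete homogeneous symmetric polynomial of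
   degree [i] evaluated at 1, ..., [k]. *)
Definition complete_sym (k i : nat) : rat :=
  fps_coef (\prod_(1 <= j < k.+1) (1 / (1 - j%:R * fpsX rat))) i.

Lemma complete_sym0 i : complete_sym 0 i = (i == 0%N)%:R.
Proof. by rewrite /complete_sym big_geq // fps_coef1. Qed.

(** Multiplying the product for [k.+1] by its last denominator gives back the product for [k];
    coefficients of degree [i] are then compared. *)
Lemma complete_symS k i : complete_sym k.+1 i =
  complete_sym k i + if i is j.+1 then k.+1%:R * complete_sym k.+1 j else 0.
Proof.
rewrite /complete_sym big_nat_recr //; set P := \prod_(_ <= _ < _) _.
have e : 1 - k.+1%:R * fpsX rat = 1 - fpsX rat * fpsC k.+1%:R.
  by rewrite fpsC_nat mulrC.
rewrite e mul1r; set V := _^-1; have : P * V * (V^-1) = P.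
  by rewrite mulrK // unitrV fps_geom_unit.
rewrite invrK => {2}<-; set PV := P * V.
rewrite mulrBr mulr1 mulrC fps_coefD fps_coefN -mulrA fps_coefXM.
by case: i => [|i]; rewrite ?subr0 ?addr0 // fps_coefCM subrK.
Qed.

Lemma thetaE n i : theta n i = complete_sym (n - i + 1) i.
Proof. by []. Qed.

(** * Counting set partitions *)

(* A partition of [0, ..., n-1] is encoded by the sequence sending each point
   to the least element of its block. *)
Fixpoint partition_seqs (n : nat) : seq (seq nat) :=
  if n is m.+1 then
    flatten [seq [seq rcons s a | a <- iota 0 m.+1 & (a == m) || (nth 0%N s a == a)]
            | s <- partition_seqs m]
  else [:: [::]].

Lemma mem_partition_seqsS n s : reflect
  (exists2 t, t \in partition_seqs n &
     exists2 a, ((a <= n) && ((a == n) || (nth 0 t a == a)))%N & s = rcons t a)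
  (s \in partition_seqs n.+1).
Proof.
apply: (iffP flatten_mapP) => -[t tn].
  case/mapP=> a; rewrite mem_filter mem_iota ltnS andbC => /= ha ->.
  by exists t => //; exists a.
case=> a ha ->; exists t => //; apply/mapP; exists a => //.
by rewrite mem_filter mem_iota ltnS andbC.
Qed.

(** A block is counted through its least element, the only one of its points that the encoding
    fixes. *)
Definition nblocks (s : seq nat) : nat :=
  count (fun i => nth 0%N s i == i) (iota 0 (size s)).

Lemma size_partition_seqs n s : s \in partition_seqs n -> size s = n.
Proof.
elim: n s => [|n IHn] s; first by rewrite inE => /eqP ->.
by case/mem_partition_seqsS=> t /IHn st [a _ ->]; rewrite size_rcons st.
Qed.

(** An idempotent map that never increases its argument sends each point to the least element of its
    fibre, so the encodings are described without recursion. *)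
Lemma partition_seqsP n s : reflect
  (size s = n /\ forall i, (i < n)%N ->
     (nth 0%N s i <= i)%N /\ nth 0%N s (nth 0%N s i) = nth 0%N s i)
  (s \in partition_seqs n).
Proof.
apply: (iffP idP).
  move=> sn; split; first exact: size_partition_seqs.
  elim: n s sn => [|n IHn] s // /mem_partition_seqsS[t tn [a /andP[an ha] ->]] i.
  have st := size_partition_seqs tn.
  rewrite ltnS leq_eqVlt => /orP[/eqP ->|ltin].
    rewrite !nth_rcons st ltnn eqxx an; split=> //.
    case/orP: ha => [/eqP ->|/eqP ta]; first by rewrite ltnn eqxx.
    by case: ltngtP an => // _ _; rewrite ta.
  have [l f] := IHn _ tn _ ltin.
  by rewrite !nth_rcons st ltin (leq_ltn_trans l ltin).
elim: n s => [|n IHn] s [ss H]; first by rewrite inE (size0nil ss).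
case: (lastP s) ss H => [//|t a]; rewrite size_rcons => -[st] H.
have tn : t \in partition_seqs n.
  apply: IHn; split=> // i ltin; have [] := H i (ltnW ltin).
  by rewrite !nth_rcons st ltin => l; rewrite (leq_ltn_trans l ltin).
have [] := H n (ltnSn n); rewrite !nth_rcons st ltnn eqxx => an fa.
apply/mem_partition_seqsS; exists t => //; exists a => //; rewrite an /=.
by case: ltngtP an fa => //= _ _ ->; rewrite eqxx.
Qed.

Lemma uniq_partition_seqs n : uniq (partition_seqs n).
Proof.
elim: n => [//|n IHn]; pose next s :=
  [seq rcons s a | a <- iota 0 n.+1 & (a == n) || (nth 0%N s a == a)].
rewrite -[partition_seqs _]/(flatten (map next (partition_seqs n))).
elim: (partition_seqs n) IHn => [//|s l IHl] /andP[sl /IHl{IHl} ul].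
rewrite map_cons -[flatten _]/(next s ++ flatten (map next l)) cat_uniq ul andbT.
apply/andP; split.
  rewrite map_inj_in_uniq ?filter_uniq ?iota_uniq // => a b _ _.
  by move/rcons_inj => [].
apply/hasPn => t /flatten_mapP[u u_l /mapP[a _ ->]]; apply/negP => /mapP[b _].
by move/rcons_inj => [us _]; rewrite us (negPf sl) in u_l.
Qed.

Lemma nblocks_le s : (nblocks s <= size s)%N.
Proof. by rewrite -[leqRHS](size_iota 0) count_size. Qed.

Lemma nblocks_rcons s a : (a <= size s)%N ->
  nblocks (rcons s a) = (nblocks s + (a == size s))%N.
Proof.
move=> sa; rewrite /nblocks size_rcons -addn1 iotaD count_cat /= addn0 add0n.
rewrite nth_rcons ltnn eqxx; congr (_ + _)%N; apply: eq_in_count => i.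
by rewrite mem_iota => /andP[_ /= li]; rewrite nth_rcons li.
Qed.

(** The recurrence of the Stirling numbers of the second kind: the new point [n] opens a block of
    its own or joins one of the [k] blocks already present. *)
Lemma count_partition_seqsS n k :
  count (fun s => nblocks s == k) (partition_seqs n.+1) =
  ((if k is j.+1 then count (fun s => nblocks s == j) (partition_seqs n) else 0)
   + k * count (fun s => nblocks s == k) (partition_seqs n))%N.
Proof.
have ext s : size s = n ->
    count (fun t => nblocks t == k)
      [seq rcons s a | a <- iota 0 n.+1 & (a == n) || (nth 0%N s a == a)] =
    ((if k is j.+1 then nblocks s == j else false) + k * (nblocks s == k))%N.
  move=> ss; rewrite count_map count_filter -addn1 iotaD count_cat /= add0n addn0.
  rewrite nblocks_rcons ss // !eqxx andbT addn1 addnC; congr (_ + _)%N.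
    by case: k => [//|k]; rewrite eqSS.
  transitivity (nblocks s * (nblocks s == k))%N; last first.
    by case: eqP => [->|]; rewrite ?muln0.
  have nbE : nblocks s = count (fun i => nth 0%N s i == i) (iota 0 n).
    by rewrite /nblocks ss.
  set b := nblocks s == k; rewrite nbE.
  transitivity (count (fun i => b && (nth 0%N s i == i)) (iota 0 n)).
    apply: eq_in_count => i; rewrite mem_iota => /andP[_ /= li].
    by rewrite /= nblocks_rcons ss ?(ltnW li) // (ltn_eqF li) addn0 //.
  case: b => /=; first by rewrite muln1.
  by rewrite muln0 count_pred0.
pose next s :=
  [seq rcons s a | a <- iota 0 n.+1 & (a == n) || (nth 0%N s a == a)].
rewrite -[partition_seqs n.+1]/(flatten (map next (partition_seqs n))).
rewrite count_flatten -map_comp.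
have := @size_partition_seqs n; elim: (partition_seqs n) => [|s l IHl] sz.
  by rewrite /= muln0; case: (k).
have IHl' := IHl (fun t tl => sz t (@mem_behead _ (s :: l) t tl)).
rewrite [LHS]/= -[sumn _]/(sumn (map _ l)) IHl' ext; last exact: sz (mem_head _ _).
by clear; case: k => [|k] /=; rewrite ?mulnDr addnACA.
Qed.

(** Both sides satisfy the same recurrence, followed by induction on [k] and, inside, on [i]. By
    [big] there are never more blocks than points, which removes the second term when [i = 0]. *)
Lemma partition_seqs_complete_sym k i :
  (count (fun s => nblocks s == k) (partition_seqs (i + k)))%:R =
  complete_sym k i.
Proof.
have big n j : (n < j)%N -> count (fun s => nblocks s == j) (partition_seqs n) = 0%N.
  move=> nj; apply/eqP; rewrite -leqn0 leqNgt -has_count; apply/hasPn => s /=.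
  move=> /size_partition_seqs ss; rewrite neq_ltn; apply/orP; left.
  by apply: leq_ltn_trans nj; rewrite -ss nblocks_le.
elim: k i => [|k IHk] i; first last.
  elim: i => [|i IHi]; rewrite complete_symS; last first.
    by rewrite addSn count_partition_seqsS natrD natrM IHi -addSnnS IHk.
  by rewrite addr0 -IHk !add0n count_partition_seqsS (@big k k.+1) // muln0 addn0.
rewrite complete_sym0 addn0; case: i => [//|i].
by rewrite count_partition_seqsS mul0n.
Qed.

(** * The residue field *)

Section MkSubmod.
Variables (R : pzRingType) (V : lmodType R) (P : {pred V}).
Hypothesis Pclosed : subsemimod_closed P.

Definition mk_submod : submodClosed V :=
  HB.pack P (GRing.isSubSemiModClosed.Build R V P Pclosed).

Lemma in_mk_submod x : (x \in mk_submod) = (x \in P).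
Proof. by []. Qed.

End MkSubmod.

Section LocalRing.
Variable R : idomainType.

Lemma principalP (a x : R) :
  reflect (exists b, x = b * a) (x \in principal_ideal a).
Proof. exact: asboolP. Qed.

Lemma nonunit_in_maximal (x : R) : x \isn't a GRing.unit ->
  exists M : submodClosed R^o, maximal_ideal M /\ x \in M.
Proof.
move=> xnu; pose ideal (A : set R^o) :=
  [/\ A 0, forall y z, A y -> A z -> A (y + z) & forall c y, A y -> A (c *: y)].
pose P (A : set R^o) := A = set0 \/ [/\ ideal A, ~ A 1 & A x].
have [F FP Ftot|A [PA Amax]] := @Zorn_bigcup R^o P.
  have [[A FA A0]|F0] := pselect (exists2 A, F A & A !=set0); last first.
    left; rewrite -subset0 => y [A FA Ay]; apply: F0.
    by exists A => //; exists y.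
  have nonempty B y : F B -> B y -> [/\ ideal B, ~ B 1 & B x].
    by move=> FB By; case: (FP B FB) => // B0; rewrite B0 in By.
  case: A0 => y Ay; have [[A0 AD AZ] _ Ax] := nonempty _ _ FA Ay.
  right; split; [split|..].
  - by exists A.
  - move=> u v [B FB Bu] [C FC Cv].
    have [[_ BD _] _ _] := nonempty _ _ FB Bu.
    have [[_ CD _] _ _] := nonempty _ _ FC Cv.
    case: (Ftot B C FB FC) => sub.
      by exists C => //; apply: CD => //; apply: sub.
    by exists B => //; apply: BD => //; apply: sub.
  - move=> c u [B FB Bu]; have [[_ _ BZ] _ _] := nonempty _ _ FB Bu.
    by exists B => //; apply: BZ.
  - by case=> B FB B1; have [_ /(_ B1)] := nonempty _ _ FB B1.
  - by exists A.
have idealS (J : submodClosed R^o) : ideal [set y | y \in J].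
  by split=> /= [|y z|c y]; [exact: rpred0|exact: rpredD|exact: rpredZ].
have [[A0 AD AZ] A1 Ax] : [/\ ideal A, ~ A 1 & A x].
  case: PA => // A0; exfalso.
  apply: (Amax [set y | y \in principal_ideal x]); last first.
    right; split; first exact: idealS.
      move=> /principalP[b b1]; move/negP: xnu; apply.
      by apply/unitrPr; exists b; rewrite mulrC.
    by apply/principalP; exists 1; rewrite mul1r.
  rewrite A0; split=> // /(_ x); apply.
  by apply/principalP; exists 1; rewrite mul1r.
have Acl : subsemimod_closed (fun y => `[< A y >] : bool).
  split; first split=> [|y z /asboolP Ay /asboolP Az]; first exact/asboolP.
    by apply/asboolP; apply: AD.
  by move=> c y /asboolP Ay; apply/asboolP; apply: AZ.
pose M := mk_submod Acl.
have inM y : (y \in M) = `[< A y >] by [].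
exists M; split; last by rewrite inM; apply/asboolP.
split=> [|J sMJ J1 y]; first by rewrite inM; apply/asboolP.
apply/idP/idP => [Jy|/sMJ //]; rewrite inM; apply/asboolP.
have [//|nAy] := pselect (A y); exfalso.
apply: (Amax [set z | z \in J]); last first.
  by right; split; [exact: idealS|exact/negP|apply: sMJ; rewrite inM; apply/asboolP].
split=> [z Az|/(_ y Jy)//]; apply: sMJ; rewrite inM; exact/asboolP.
Qed.

Variable p : R.
Hypotheses (dvrR : is_dvr R) (unifp : uniformizer p).

(** A nonunit lies in some maximal ideal, and by locality that ideal is the one generated by [p]. *)
Lemma dvr_unit (x : R) : x \notin principal_ideal p -> x \is a GRing.unit.
Proof.
apply: contraR => /nonunit_in_maximal[M [Mmax Mx]].
have [N [_ Nuniq]] := dvr_local dvrR.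
by rewrite (Nuniq _ unifp) -(Nuniq _ Mmax).
Qed.

Lemma uniformizer_neq0 : p != 0.
Proof.
have [x [x0 xnu]] := dvr_nonfield dvrR.
apply/eqP => p0; move/eqP: x0; apply.
have [//|/dvr_unit] := boolP (x \in principal_ideal p); last by rewrite (negPf xnu).
by case/principalP=> b; rewrite p0 mulr0.
Qed.

End LocalRing.

Lemma submodClosed_ext (R : pzRingType) (V : lmodType R) (L M : submodClosed V) :
  L =i M -> L = M.
Proof.
case: L M => [P [[aP] [sP]]] [Q [[aQ] [sQ]]] e.
have PQ : P = Q by apply/funext => x; exact: e.
by subst Q; rewrite (Prop_irrelevance aP aQ) (Prop_irrelevance sP sQ).
Qed.

Section Quotient.
Variables (R : pzRingType) (V : lmodType R) (M : submodClosed V).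
Local Notation pi_q := (\pi_(quotmod M)%qT).

Lemma quotmod_pi0 : pi_q 0 = 0.
Proof. by apply: (addIr (pi_q 0)); rewrite -quotmod_piD !add0r. Qed.

Lemma quotmod_pi_eq0 x : pi_q x = 0 <-> x \in M.
Proof.
rewrite -quotmod_pi0; split=> [/quotmod_eqP|xM]; first by rewrite subr0.
by apply/quotmod_eqP; rewrite subr0.
Qed.

Lemma quotmod_piZ a x : pi_q (a *: x) = a *: pi_q x.
Proof. exact/esym/quotmod_scale_pi. Qed.

Lemma quotmod_piB x y : pi_q (x - y) = pi_q x - pi_q y.
Proof. by rewrite quotmod_piD -scaleN1r quotmod_piZ scaleN1r. Qed.

End Quotient.

Section ResidueField.
Variables (R : idomainType) (p : R).
Hypotheses (dvrR : is_dvr R) (unifp : uniformizer p).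

Local Notation quot := (quotmod (principal_ideal p)).
Local Notation pi_q := (\pi_quot%qT).

Let mulq (x y : quot) : quot := pi_q (repr x * repr y).

Let mulq_pi x y : mulq (pi_q x) (pi_q y) = pi_q (x * y).
Proof.
apply/quotmod_eqP/principalP.
have repr_pi z : exists b, repr (pi_q z) = z + b * p.
  have /quotmod_eqP/principalP[b e] : pi_q (repr (pi_q z)) = pi_q z by rewrite reprK.
  by exists b; rewrite -e addrC subrK.
have [b ->] := repr_pi x; have [c ->] := repr_pi y.
exists (x * c + b * (y + c * p)).
rewrite mulrDl mulrDr -[X in X - _]addrA [LHS]addrC addKr mulrDl.
by rewrite !mulrA [b * p * _]mulrAC.
Qed.

(** Inverses exist because a representative of a nonzero class lies outside the maximal ideal, hence
    is a unit. Finiteness is transported along the bijection with the integers below [q]. *)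
Lemma residue_field (q : nat) : ([set: quot] #= `I_q)%card ->
  exists (F : finFieldType) (rho : {rmorphism R -> F}),
    [/\ forall y, exists x, rho x = y,
        forall x, rho x = 0 <-> exists b, x = b * p &
        #|F| = q].
Proof.
move=> hq.
have mulqA : associative mulq.
  elim/quotW=> x; elim/quotW=> y; elim/quotW=> z.
  by rewrite (mulq_pi y z) (mulq_pi x y) !mulq_pi mulrA.
have mulqC : commutative mulq.
  by elim/quotW=> x; elim/quotW=> y; rewrite !mulq_pi mulrC.
have mul1q : left_id (pi_q 1) mulq.
  by elim/quotW=> x; rewrite mulq_pi mul1r.
have mulqD : left_distributive mulq +%R.
  elim/quotW=> x; elim/quotW=> y; elim/quotW=> z.
  by rewrite -quotmod_piD (mulq_pi x z) (mulq_pi y z) mulq_pi -quotmod_piD mulrDl.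
have oneq : pi_q 1 != 0 :> quot.
  apply/eqP; rewrite -quotmod_pi0 => /quotmod_eqP; rewrite subr0.
  exact/negP/(proj1 unifp).
pose invq (x : quot) : quot := if x == 0 then 0 else pi_q (repr x)^-1.
have mulVq x : x != 0 -> mulq (invq x) x = pi_q 1.
  move=> x0; rewrite /invq (negPf x0) -{2}[x]reprK mulq_pi mulVr //.
  apply: (dvr_unit dvrR unifp); apply: contra x0 => rx.
  by apply/eqP; rewrite -[x]reprK -quotmod_pi0; apply/quotmod_eqP; rewrite subr0.
have invq0 : invq 0 = 0 by rewrite /invq eqxx.
pose ringmix := GRing.Zmodule_isComNzRing.Build quot mulqA mulqC mul1q mulqD oneq.
pose Rg : comNzRingType := HB.pack quot ringmix.
pose fieldmix := GRing.ComNzRing_isField.Build Rg mulVq invq0.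
have [f fbij] := card_set_bijP hq.
pose g i : quot := if pselect (exists x, f x = i) is left e then projT1 (cid e) else 0.
have fK : cancel f g.
  move=> x; rewrite /g; case: pselect => [e|[]]; last by exists x.
  case: (cid e) => y /= fyx; case: fbij => _ finj _.
  exact: (finj y x (mem_set I) (mem_set I) fyx).
pose cmix := CanIsCountable fK.
have enumP : Finite.axiom (map g (iota 0 q)).
  move=> x; rewrite count_uniq_mem.
    suff -> : x \in map g (iota 0 q) by [].
    apply/mapP; exists (f x); rewrite ?fK // mem_iota add0n.
    by case: fbij => fI _ _; apply: fI.
  rewrite map_inj_in_uniq ?iota_uniq // => i j.
  rewrite !mem_iota !add0n /= => iq jq.
  have [_ _ fsurj] := fbij.
  have [y _ <-] := fsurj i iq; have [z _ <-] := fsurj j jq.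
  by rewrite !fK => ->.
pose fmix := isFinite.Build quot enumP.
pose F : finFieldType := HB.pack quot ringmix fieldmix cmix fmix.
have piM : monoid_morphism (fun x : R => pi_q x : F).
  by split=> // x y; rewrite -mulq_pi.
have piB : zmod_morphism (fun x : R => pi_q x : F).
  move=> x y; apply/esym/eqP; rewrite subr_eq; apply/eqP.
  by rewrite -[RHS]quotmod_piD subrK.
pose rho : {rmorphism R -> F} := HB.pack (fun x : R => pi_q x : F)
  (GRing.isZmodMorphism.Build R F _ piB) (GRing.isMonoidMorphism.Build R F _ piM).
exists F, rho; split.
- by move=> y; exists (repr (y : quot)); rewrite -[RHS](@reprK _ quot).
- move=> x; split=> [|[b ->]].
    by rewrite -[0 in RHS]quotmod_pi0 => /quotmod_eqP; rewrite subr0 => /principalP.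
  rewrite -[RHS]quotmod_pi0; apply/quotmod_eqP; rewrite subr0; apply/principalP.
  by exists b.
by rewrite cardE enumT unlock /= size_map size_iota.
Qed.

End ResidueField.

(** * Counting subspaces *)

Section FullRankCount.
Local Open Scope set_scope.
Variable F : finFieldType.

Lemma row_full_row_mx n m (v : 'cV[F]_n) (A : 'M[F]_(n, m)) :
  row_full (row_mx v A) = row_full A && (v \notin [set A *m w | w : 'cV_m]).
Proof.
apply/idP/andP => [/row_fullP[X]|[/row_fullP[C CA] vA]].
  rewrite -[X]vsubmxK mul_col_row (@scalar_mx_block _ 1) => /eq_block_mx[uv uA dv dA].
  split; first by apply/row_fullP; exists (dsubmx X).
  apply/imsetP => -[w _ vE]; move: uv.
  rewrite vE mulmxA uA mul0mx => /matrixP/(_ 0 0); rewrite !mxE => /eqP.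
  by rewrite eq_sym oner_eq0.
pose z := v - A *m (C *m v).
have /cV0Pn[i zi] : z != 0.
  by apply: contra vA => /eqP/subr0_eq ->; apply/imsetP; exists (C *m v).
(* The rows of [1 - A C] kill [A]; one of them, scaled by the inverse of a nonzero entry of [z],
   takes [v] to 1. *)
pose y : 'rV_n := (z i 0)^-1 *: delta_mx 0 i *m (1%:M - A *m C).
have yA : y *m A = 0.
  by rewrite /y -mulmxA mulmxBl mul1mx -(mulmxA A) CA mulmx1 subrr mulmx0.
have yv : y *m v = 1%:M.
  rewrite /y -mulmxA mulmxBl mul1mx -(mulmxA A) -/z -scalemxAl -rowE.
  by apply/matrixP => a b; rewrite !ord1 mxE [row i z _ _]mxE mulVf // mxE.
move: y yA yv => y yA yv.
apply/row_fullP; exists (col_mx y (C - C *m v *m y)).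
rewrite mul_col_row yA yv !mulmxBl -!mulmxA yA yv CA !mulmx0 mulmx1 subrr subr0.
by rewrite (@scalar_mx_block _ 1).
Qed.

(** Columns are chosen one at a time: given [m] independent columns, a further one has to avoid
    their span, which has [#|F| ^ m] elements. *)
Lemma card_row_full n m : #|[set A : 'M[F]_(n, m) | row_full A]| =
  (\prod_(0 <= i < m) (#|F| ^ n - #|F| ^ i))%N.
Proof.
elim: m => [|m IHm].
  rewrite big_geq // -[RHS](cards1 (0 : 'M[F]_(n, 0))); apply: eq_card => A.
  by rewrite !inE -col_leq_rank (thinmx0 A) eqxx.
rewrite big_nat_recr //= -{}IHm.
pose P (A : 'M[F]_(n, m)) := row_full A.
pose Q (A : 'M[F]_(n, m)) (v : 'cV_n) := v \notin [set A *m w | w : 'cV_m].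
pose f (u : 'M[F]_(n, m) * 'cV[F]_n) : 'M_(n, m.+1) := row_mx u.2 u.1.
have finj : injective f by move=> [A v] [B w] /(@eq_row_mx _ n 1 m)[/= -> ->].
transitivity #|f @: [set u | P u.1 && Q u.1 u.2]|.
  apply: eq_card => A; rewrite inE; apply/idP/imsetP => [fA|[u + ->]]; last first.
    by rewrite inE row_full_row_mx.
  have AE : A = f (rsubmx (A : 'M_(n, 1 + m)), lsubmx (A : 'M_(n, 1 + m))).
    by rewrite /f hsubmxK.
  by exists (rsubmx (A : 'M_(n, 1 + m)), lsubmx (A : 'M_(n, 1 + m))); rewrite // inE;
    rewrite AE row_full_row_mx in fA.
rewrite card_imset // -sum1_card.
under eq_bigl do rewrite inE.
rewrite -(pair_big_dep P Q (fun _ _ => 1%N)) /= -sum_nat_const.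
apply: eq_big => [A|A /row_fullP[C CA]]; first by rewrite inE.
rewrite sum1_card -/(Q A).
have -> : #|Q A| = #|~: [set A *m w | w : 'cV_m]| by apply: eq_card => v; rewrite !inE.
rewrite cardsCs finset.setCK card_imset ?card_mx ?muln1 //.
by apply: can_inj (mulmx C) _ => w; rewrite mulmxA CA mul1mx.
Qed.

Definition left_ker n m (A : 'M[F]_(n, m)) : {set 'rV[F]_n} := [set x | x *m A == 0].

(** The rows of [1 - A C] lie in the kernel of [A], hence in that of [B], so [B = A (C B)]; a left
    inverse of [B] then shows that [C B] is invertible. *)
Lemma left_kerP n m (A B : 'M[F]_(n, m)) : row_full A -> row_full B ->
  left_ker A = left_ker B <-> exists2 U, U \in unitmx & B = A *m U.
Proof.
move=> /row_fullP[C CA] /row_fullP[E EB]; split=> [/setP e|[U Uu ->]]; last first.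
  apply/setP => x; rewrite !inE mulmxA; apply/eqP/eqP => [->|]; first exact: mul0mx.
  by move/(congr1 (mulmx^~ (invmx U))); rewrite mulmxK // mul0mx.
have BE : B = A *m (C *m B).
  apply/subr0_eq/row_matrixP => i; rewrite mulmxA -{1}[B]mul1mx -mulmxBl row_mul.
  rewrite row0; apply/eqP; have := e (row i (1%:M - A *m C)); rewrite !inE => <-.
  by rewrite -row_mul mulmxBl mul1mx -mulmxA CA mulmx1 subrr row0.
exists (C *m B) => //; move: EB; rewrite BE mulmxA -BE.
by case/mulmx1_unit.
Qed.

(** The matrices with a given kernel form one free orbit under right multiplication by the general
    linear group of rank [m]. *)
Lemma card_left_ker n m :
  (#|[set left_ker A | A in [set A : 'M[F]_(n, m) | row_full A]]| *
   \prod_(0 <= i < m) (#|F| ^ m - #|F| ^ i))%N =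
  (\prod_(0 <= i < m) (#|F| ^ n - #|F| ^ i))%N.
Proof.
rewrite -!card_row_full -[in RHS]sum1_card -sum_nat_const.
rewrite [RHS](partition_big_imset (@left_ker n m)) /=.
apply: eq_bigr => V /imsetP[A + ->]; rewrite inE => fA {V}.
rewrite sum1dep_card -(card_imset _ (row_full_inj fA)) /=.
apply: eq_card => B; rewrite !inE; apply/imsetP/andP => [[U]|[fB /eqP e]].
  rewrite inE row_full_unit => Uu ->; have /row_fullP[C CA] := fA.
  have fAU : row_full (A *m U).
    apply/row_fullP; exists (invmx U *m C).
    by rewrite mulmxA -(mulmxA _ C) CA mulmx1 mulVmx.
  by split=> //; apply/eqP/esym/left_kerP => //; exists U.
have [U Uu BE] := (left_kerP fA fB).1 (esym e).
by exists U; rewrite // inE row_full_unit.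
Qed.

Lemma card_left_ker_gauss n m : (m <= n)%N ->
  #|[set left_ker A | A in [set A : 'M[F]_(n, m) | row_full A]]|%:R =
  gauss_binomial #|F| n m.
Proof.
have q1 : (1 < #|F|)%N := card_finNzRing_gt1 F.
move=> mn; have /(congr1 (fun k => k%:R : rat)) := card_left_ker n m.
(* Here [q^k - q^i = q^i (q^(k - i) - 1)]; the powers [q^i] are common to both sides and cancel. *)
have qE k : (m <= k)%N -> (\prod_(0 <= i < m) (#|F| ^ k - #|F| ^ i))%N%:R =
    \prod_(0 <= i < m) (#|F|%:R ^+ i) * \prod_(0 <= i < m) (#|F|%:R ^+ (k - i) - 1)
    :> rat.
  move=> mk; rewrite natr_prod -big_split /=; apply: eq_big_nat => i /andP[_ im].
  have ik : (i <= k)%N by rewrite ltnW // (leq_trans im).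
  by rewrite natrB ?leq_exp2l // !natrX mulrBr mulr1 -exprD subnKC.
have q0 : #|F|%:R != 0 :> rat by rewrite pnatr_eq0 -lt0n ltnW.
have pw i : (0 < i)%N -> (#|F|%:R ^+ i - 1 : rat) != 0.
  move=> i0; rewrite subr_eq0 -natrX pnatr_eq1.
  by rewrite -(expn0 #|F|) eqn_exp2l // -lt0n.
have p0 : \prod_(0 <= i < m) (#|F|%:R ^+ i) != 0 :> rat.
  by rewrite big_mkord; apply/prodf_neq0 => i _; rewrite expf_neq0.
rewrite natrM !qE // mulrCA => /(mulfI p0) h.
have pm : \prod_(0 <= i < m) (#|F|%:R ^+ (m - i) - 1) != 0 :> rat.
  by rewrite big_mkord; apply/prodf_neq0 => i _; rewrite pw // subn_gt0.
apply: (mulIf pm); rewrite h /gauss_binomial -big_split /=.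
apply: eq_big_nat => i /andP[_ im].
have := pw _ (etrans (subn_gt0 i m) im); rewrite -(opprB 1) oppr_eq0 => ne0.
by rewrite mulrN divfK // opprB.
Qed.

End FullRankCount.

(** Cardinality is carried by an explicit injective enumeration, so that fibrewise counts come from
    products of finite types; [ncard] enters only at the end. *)
Definition has_card (X : Type) (P : set X) (k : nat) : Prop :=
  exists (T : finType) (g : T -> X),
    [/\ #|T| = k, injective g & forall x, P x <-> exists t, x = g t].

Lemma ncard_has_card (X : Type) (P : set X) k : has_card P k -> ncard P = k.
Proof.
move=> [T [g [Tk ginj gP]]]; apply: card_fset_set.
have -> : P = g @` [set: T].
  apply/seteqP; split=> x; first by move=> /gP[t ->]; exists t.
  by case=> t _ <-; apply/gP; exists t.
have gi : {in [set: T] &, injective g} by move=> x y _ _; apply: ginj.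
apply: card_eq_trans (inj_card_eq gi) _; rewrite -Tk.
apply: card_eq_trans (card_esym card_II); apply/card_esym.
have ev : {in [set: 'I_#|T|] &, injective (@enum_val T predT)}.
  by move=> x y _ _; apply: enum_val_inj.
rewrite (_ : [set: T] = enum_val @` [set: 'I_#|T|]); first exact/card_esym/inj_card_eq.
by apply/seteqP; split=> x // _; exists (enum_rank x); rewrite ?enum_rankK.
Qed.

Lemma has_card_preim (X Y : Type) (P : set X) (Q : set Y) (f : Y -> X) k :
  (forall y, Q y -> P (f y)) ->
  (forall x, P x -> exists2 y, Q y & f y = x) ->
  {in Q &, injective f} -> has_card P k -> has_card Q k.
Proof.
move=> QP PQ finj [T [g [Tk ginj gP]]].
have h t : exists y, Q y /\ f y = g t.
  by have [|y Qy fy] := PQ (g t); [apply/gP; exists t|exists y].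
pose c t := projT1 (cid (h t)).
have cP t : Q (c t) /\ f (c t) = g t by rewrite /c; case: cid.
exists T, c; split=> // [s t e|y].
  by apply: ginj; rewrite -(cP s).2 -(cP t).2 e.
split=> [Qy|[t ->]]; last exact: (cP t).1.
have [t yt] := (gP _).1 (QP y Qy); exists t.
by apply: (finj _ _ (mem_set Qy) (mem_set (cP t).1)); rewrite (cP t).2.
Qed.

Lemma row_full_complement (F : fieldType) n m (A : 'M[F]_(n, m)) : row_full A ->
  exists (D : 'M[F]_(n, n - m)) (X : 'M[F]_(m + (n - m), n)),
    row_mx A D *m X = 1%:M /\ X *m row_mx A D = 1%:M.
Proof.
move=> /eqP rA; have mn : (m <= n)%N by rewrite -rA rank_leq_row.
have [D DE] : exists D : 'M[F]_(n - m, n), (D :=: (A^T)^C)%MS.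
  have : \rank (A^T)^C%MS = (n - m)%N by rewrite mxrank_compl mxrank_tr rA.
  by move=> <-; exists (row_base (A^T)^C%MS); exact: eq_row_base.
have full : row_full (col_mx A^T D).
  rewrite -sub1mx -addsmxE (adds_eqmx (eqmx_refl _) DE) sub1mx.
  exact: addsmx_compl_full.
exists D^T.
have e : (m + (n - m) = n)%N by rewrite subnKC.
have /row_fullP[X XE] := full; exists X^T.
have left : row_mx A D^T *m X^T = 1%:M.
  by rewrite -[row_mx _ _]trmxK tr_row_mx trmxK -trmx_mul XE trmx1.
split=> //.
(* [m + (n - m)] and [n] are not convertible; generalising the width makes the matrices square,
   where a one-sided inverse is two-sided. *)
move: e (row_mx _ _) (X^T) left; clear.
by move: (m + (n - m))%N => N -> Y Z; exact: mulmx1C.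
Qed.

(** * Lattices cut out by congruences *)

Section Lattices.
Variables (R : idomainType) (p : R) (F : finFieldType) (rho : {rmorphism R -> F}).
Hypotheses (p_neq0 : p != 0) (rho_surj : forall y, exists x, rho x = y).
Hypothesis rho_ker : forall x, rho x = 0 <-> exists b, x = b * p.
Hypothesis rho_unit : forall x, rho x != 0 -> x \is a GRing.unit.

(** A set-theoretic section of the reduction map, in general neither additive nor multiplicative. *)
Definition lift (y : F) : R := projT1 (cid (rho_surj y)).

Lemma liftK y : rho (lift y) = y.
Proof. by rewrite /lift; case: cid. Qed.

Local Notation "A ^r" := (map_mx rho A) (at level 2, format "A ^r").
Local Notation "A ^l" := (map_mx lift A) (at level 2, format "A ^l").

Lemma lift_mxK n m (A : 'M[F]_(n, m)) : A^l^r = A.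
Proof. by apply/matrixP => i j; rewrite !mxE liftK. Qed.

Lemma rho_p : rho p = 0.
Proof. by apply/rho_ker; exists 1; rewrite mul1r. Qed.

Lemma rho_pZ k n m (X : 'M[R]_(n, m)) : (0 < k)%N -> (p ^+ k *: X)^r = 0.
Proof.
case: k => // k _; apply/matrixP => i j.
by rewrite !mxE rmorphM rmorphXn rho_p expr0n mul0r.
Qed.

Lemma rho_mx_ker n m (X : 'M[R]_(n, m)) : X^r = 0 -> exists D, X = p *: D.
Proof.
move=> X0; have h i j : exists b, X i j = b * p.
  by apply/rho_ker; have /matrixP/(_ i j) := X0; rewrite !mxE.
exists (\matrix_(i, j) projT1 (cid (h i j))); apply/matrixP => i j.
by rewrite !mxE mulrC; case: cid.
Qed.

Lemma scale_pI k n m : injective (fun X : 'M[R]_(n, m) => p ^+ k *: X).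
Proof.
move=> X Y /matrixP e; apply/matrixP => i j; have := e i j; rewrite !mxE.
by apply: mulfI; rewrite expf_neq0.
Qed.

Lemma unitmx_rho n (U : 'M[R]_n) : U^r \in unitmx -> U \in unitmx.
Proof. by rewrite !unitmxE det_map_mx unitfE => /rho_unit. Qed.

Definition left_invertible n m (A : 'M[R]_(n, m)) : Prop :=
  exists C, C *m A = 1%:M.

(** A left inverse modulo [p] lifts to some [C] with [C A] congruent to the identity, so [C A] has
    unit determinant and [C] can be corrected. *)
Lemma left_invertibleP n m (A : 'M[R]_(n, m)) :
  left_invertible A <-> row_full A^r.
Proof.
split=> [[C CA]|/row_fullP[C CA]].
  by apply/row_fullP; exists C^r; rewrite -map_mxM CA map_mx1.
have CAu : C^l *m A \in unitmx.
  by apply: unitmx_rho; rewrite map_mxM lift_mxK CA unitmx1.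
by exists (invmx (C^l *m A) *m C^l); rewrite -mulmxA mulVmx.
Qed.

(** For left invertible [A] this is the kernel of a surjection onto [m] copies of [R / p^r]. *)
Definition lat n m r (A : 'M[R]_(n, m)) : set 'rV[R]_n :=
  [set x | exists y, x *m A = p ^+ r *: y].

Lemma lat_le n m k r (A : 'M[R]_(n, m)) : (k <= r)%N -> lat r A `<=` lat k A.
Proof.
move=> kr x [y xA]; exists (p ^+ (r - k) *: y).
by rewrite xA scalerA -exprD subnKC.
Qed.

Lemma lat0 n m (A : 'M[R]_(n, m)) x : lat 0 A x.
Proof. by exists (x *m A); rewrite expr0 scale1r. Qed.

Lemma latZ n m r (A : 'M[R]_(n, m)) x : lat r A (p ^+ r *: x).
Proof. by exists (x *m A); rewrite scalemxAl. Qed.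

Lemma latD n m r (A : 'M[R]_(n, m)) x y :
  lat r A x -> lat r A y -> lat r A (x + y).
Proof. by move=> [u xA] [v yA]; exists (u + v); rewrite mulmxDl xA yA scalerDr. Qed.

Lemma lat_scale n m r (A : 'M[R]_(n, m)) c x : lat r A x -> lat r A (c *: x).
Proof.
by move=> [u xA]; exists (c *: u); rewrite -scalemxAl xA !scalerA mulrC.
Qed.

(** Subtracting [p^r y C] turns the congruence into an equation. Thus the lattice is the exact
    kernel of [A] plus all multiples of [p^r]. *)
Lemma lat_decomp n m r (A : 'M[R]_(n, m)) x : left_invertible A -> lat r A x ->
  exists x' u, x = x' + p ^+ r *: u /\ x' *m A = 0.
Proof.
move=> [C CA] [y xA]; exists (x - p ^+ r *: y *m C), (y *m C).
rewrite -scalemxAl subrK; split=> //.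
by rewrite mulmxBl -scalemxAl -mulmxA CA mulmx1 xA subrr.
Qed.

Lemma ker_lat n m r (A : 'M[R]_(n, m)) x : x *m A = 0 -> lat r A x.
Proof. by move=> xA; exists 0; rewrite xA scaler0. Qed.

Lemma lat_mulr n m k r (A : 'M[R]_(n, m)) (U : 'M[R]_(m, k)) D :
  lat r A `<=` lat r (A *m U + p ^+ r *: D).
Proof.
move=> x [y xA]; exists (y *m U + x *m D).
by rewrite mulmxDr mulmxA xA -scalemxAl -scalemxAr scalerDr.
Qed.

Lemma lat_subset n m k r (A : 'M[R]_(n, m)) (B : 'M[R]_(n, k)) C :
  C *m A = 1%:M -> lat r A `<=` lat r B ->
  exists D, B = A *m (C *m B) + p ^+ r *: D.
Proof.
move=> CA sAB.
have h i : exists y, row i (1%:M - A *m C) *m B = p ^+ r *: y.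
  apply/sAB/ker_lat.
  by rewrite -row_mul mulmxBl mul1mx -mulmxA CA mulmx1 subrr row0.
exists (\matrix_i projT1 (cid (h i))).
apply/eqP; rewrite addrC -subr_eq; apply/eqP/row_matrixP => i.
rewrite linearZ /= rowK; case: cid => y /= <-.
by rewrite -row_mul mulmxBl mul1mx mulmxA.
Qed.

Lemma lat_subset_unit n m r (A B : 'M[R]_(n, m)) C : (0 < r)%N ->
  C *m A = 1%:M -> left_invertible B -> lat r A `<=` lat r B ->
  C *m B \in unitmx.
Proof.
move=> r0 CA [CB CBB] /(lat_subset CA)[D BE].
apply: unitmx_rho; set U := C *m B in BE *.
have : (CB *m A)^r *m U^r = 1%:M.
  rewrite -map_mxM -mulmxA -(map_mx1 rho) -CBB [in RHS]BE mulmxDr map_mxD.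
  by rewrite -scalemxAr rho_pZ // addr0.
by case/mulmx1_unit.
Qed.

(** The inclusion gives [B = A U] modulo [p^r] with [U] invertible, and this can be solved for
    [A]. *)
Lemma lat_eq n m r (A B : 'M[R]_(n, m)) : (0 < r)%N ->
  left_invertible A -> left_invertible B -> lat r A `<=` lat r B ->
  lat r A = lat r B.
Proof.
move=> r0 [C CA] Bl sAB; apply/seteqP; split=> //.
have Uu := lat_subset_unit r0 CA Bl sAB.
have [D BE] := lat_subset CA sAB; set U := C *m B in Uu BE.
have -> : A = B *m invmx U + p ^+ r *: - (D *m invmx U).
  by rewrite {1}BE mulmxDl -mulmxA mulmxV // mulmx1 -scalemxAl scalerN addrK.
exact: lat_mulr.
Qed.

Lemma lat_width_le n m k r (A : 'M[R]_(n, m)) (B : 'M[R]_(n, k)) : (0 < r)%N ->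
  left_invertible A -> left_invertible B -> lat r A `<=` lat r B -> (k <= m)%N.
Proof.
move=> r0 [C CA] /left_invertibleP /eqP rB /(lat_subset CA)[D BE].
rewrite -rB BE map_mxD rho_pZ // addr0 map_mxM.
exact: leq_trans (mxrankM_maxl _ _) (rank_leq_col _).
Qed.

Definition is_lat n m r (M : set 'rV[R]_n) : Prop :=
  exists A : 'M[R]_(n, m), left_invertible A /\ M = lat r A.

(** The preimage of the image of [M] modulo [p^k], so that truncation to a lower precision stays
    among sets of vectors over [R]. *)
Definition reduce n k (M : set 'rV[R]_n) : set 'rV[R]_n :=
  [set x | exists y u, M y /\ x = y + p ^+ k *: u].

Lemma reduce_lat n m k r (A : 'M[R]_(n, m)) : (k <= r)%N -> left_invertible A ->
  reduce k (lat r A) = lat k A.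
Proof.
move=> kr Al; apply/seteqP; split=> x.
  by case=> y [u [/(lat_le kr) yM ->]]; apply: latD => //; exact: latZ.
move=> /(lat_decomp Al)[x' [u [-> x'A]]]; exists x', u; split=> //.
exact: ker_lat.
Qed.

Definition rmul n (x y : 'rV[R]_n) : 'rV[R]_n := \row_j (x 0 j * y 0 j).

Lemma rmulDl n (x y z : 'rV[R]_n) : rmul (x + y) z = rmul x z + rmul y z.
Proof. by apply/rowP => j; rewrite !mxE mulrDl. Qed.

Lemma rmulDr n (x y z : 'rV[R]_n) : rmul z (x + y) = rmul z x + rmul z y.
Proof. by apply/rowP => j; rewrite !mxE mulrDr. Qed.

Lemma rmulZl n c (x y : 'rV[R]_n) : rmul (c *: x) y = c *: rmul x y.
Proof. by apply/rowP => j; rewrite !mxE mulrA. Qed.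

Lemma rmulZr n c (x y : 'rV[R]_n) : rmul x (c *: y) = c *: rmul x y.
Proof. by apply/rowP => j; rewrite !mxE mulrCA. Qed.

Definition mulclosed n (M : set 'rV[R]_n) : Prop :=
  forall x y, M x -> M y -> M (rmul x y).

(** With [M = lat r A], the left side expresses that [p^r0 M] is multiplicatively closed. Modulo
    [p^(r - r0)] vectors may be replaced by vectors in the exact kernel of [A], which lie in the
    lattice of every precision; then [p^r0] is cancelled. *)
Lemma mulclosed_scale n m r0 r (A : 'M[R]_(n, m)) : left_invertible A ->
  (forall x y, lat r A x -> lat r A y -> lat r A (p ^+ r0 *: rmul x y)) <->
  mulclosed (lat (r - r0) A).
Proof.
move=> Al; split=> [H x y|H x y]; last first.
  move=> /(lat_le (leq_subr r0 r)) xM /(lat_le (leq_subr r0 r)) yM.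
  have [z zE] := H _ _ xM yM; apply: (@lat_le _ _ _ (r0 + (r - r0))).
    by rewrite -leq_subLR.
  by exists z; rewrite -scalemxAl zE scalerA exprD.
have [le_r|lt_r] := leqP r r0; first by move: le_r => /eqP -> _ _; exact: lat0.
move=> /(lat_decomp Al)[x' [u [-> x'A]]] /(lat_decomp Al)[y' [v [-> y'A]]].
rewrite rmulDl rmulDr rmulZl !rmulZr -addrA -scalerDr.
apply: latD; last exact: latZ.
have [z] := H _ _ (ker_lat r x'A) (ker_lat r y'A).
rewrite -{1}(subnKC (ltnW lt_r)) exprD -scalerA -scalemxAl => /scale_pI zE.
by exists z.
Qed.

Lemma rho_addp k n m (X Y : 'M[R]_(n, m)) : (0 < k)%N -> (X + p ^+ k *: Y)^r = X^r.
Proof. by move=> k0; rewrite map_mxD rho_pZ // addr0. Qed.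

Lemma left_invertible_addp k n m (X Y : 'M[R]_(n, m)) : (0 < k)%N ->
  left_invertible X -> left_invertible (X + p ^+ k *: Y).
Proof. by move=> k0 /left_invertibleP h; apply/left_invertibleP; rewrite rho_addp. Qed.

Lemma lat_addp k r n m (A Y : 'M[R]_(n, m)) : (r <= k)%N ->
  lat r (A + p ^+ k *: Y) = lat r A.
Proof.
move=> rk; have sub B Z : lat r B `<=` lat r (B + p ^+ k *: Z).
  rewrite -{2}[B]mulmx1 -(subnKC rk) exprD -scalerA; exact: lat_mulr.
apply/seteqP; split; last exact: sub.
by rewrite -{2}[A](addrK (p ^+ k *: Y)) -scalerN; exact: sub.
Qed.

Lemma left_invertible_mul n m (A : 'M[R]_(n, m)) U :
  U \in unitmx -> left_invertible A -> left_invertible (A *m U).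
Proof.
move=> Uu [C CA]; exists (invmx U *m C).
by rewrite mulmxA -(mulmxA _ C) CA mulmx1 mulVmx.
Qed.

(** * Lifting a lattice by one power of [p] *)

Section Fibre.
Variables (n m r : nat) (A : 'M[R]_(n, m)) (D : 'M[F]_(n, n - m)).
Variable X : 'M[F]_(m + (n - m), n).
Hypotheses (r_gt0 : (0 < r)%N) (Al : left_invertible A).
Hypotheses (DX : row_mx A^r D *m X = 1%:M) (XD : X *m row_mx A^r D = 1%:M).

(** A perturbation [p^r A V] only multiplies [A] on the right by the invertible [1 + p^r V] and
    leaves the lattice unchanged, hence the directions along the complement [D] are the ones
    kept. *)
Definition fibre (W : 'M[F]_(n - m, m)) := A + p ^+ r *: (D *m W)^l.

(** Both matrices are [A] modulo [p^r], so the change of basis [U] is the identity modulo [p^r].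
    Dividing by [p^r] and reducing leaves [D W2 = D W1 + A V], and the columns of [A] and [D] are
    independent. *)
Lemma fibre_inj : injective (fun W => lat r.+1 (fibre W)).
Proof.
move=> W1 W2 e; have [C CA] := Al.
have fl W : left_invertible (fibre W) by exact: left_invertible_addp.
have [C1 CA1] := fl W1.
have sub : lat r.+1 (fibre W1) `<=` lat r.+1 (fibre W2) by rewrite e.
have [E BE] := lat_subset CA1 sub.
set U := C1 *m _ in BE; set L1 := (D *m W1)^l; set L2 := (D *m W2)^l.
rewrite /fibre -/L1 -/L2 exprSr -scalerA in BE.
have [V UE] : exists V, U = 1%:M + p ^+ r *: V.
  exists (C *m L2 - C *m L1 *m U - p *: (C *m E)).
  have := congr1 (mulmx C) BE; rewrite !mulmxDr mulmxA mulmxDr CA.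
  rewrite mulmxDl mul1mx -!scalemxAr -scalemxAl !scalerBr => h.
  by rewrite -addrA -opprD addrA h -[X in X - _]addrA addrK.
have := BE; rewrite UE mulmxDr mulmx1 -scalemxAr -!addrA -!scalerDr.
move=> /addrI/scale_pI/(congr1 (map_mx rho)).
rewrite !map_mxD -[p]expr1 rho_pZ // addr0 map_mxM rho_addp // !lift_mxK => DW.
have : row_mx A^r D *m col_mx V^r (W1 - W2) = 0.
  by rewrite mul_row_col mulmxBr DW opprD addNKr subrr.
move=> /(congr1 (mulmx X)); rewrite mulmxA XD mul1mx mulmx0 => /(congr1 dsubmx).
by rewrite col_mxKd linear0 => /subr0_eq.
Qed.

Lemma fibre_surj (B : 'M[R]_(n, m)) : left_invertible B -> lat r B = lat r A ->
  exists W, lat r.+1 B = lat r.+1 (fibre W).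
Proof.
move=> Bl eBA; have [C CB] := Bl.
have sub : lat r B `<=` lat r A by rewrite eBA.
have Uu := lat_subset_unit r_gt0 CB Al sub.
have [E AE] := lat_subset CB sub; set U := C *m A in Uu AE.
have BU : B *m U = A - p ^+ r *: E by rewrite {1}AE addrK.
(* [Y] contains the coordinates of [- E] modulo [p] in the columns of [A] and [D]: the lower part is
   the wanted [W], the upper part is absorbed in a factor [1 + p^r V]. *)
pose Y := X *m - E^r; pose W := dsubmx Y; exists W; set V := (usubmx Y)^l.
have YE : - E^r = A^r *m usubmx Y + D *m W.
  by rewrite -mul_row_col vsubmxK mulmxA DX mul1mx.
have [H HE] : exists H, - E = A *m V + (D *m W)^l + p *: H.
  have [|H HE] := @rho_mx_ker _ _ (- E - (A *m V + (D *m W)^l)).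
    by rewrite map_mxB map_mxN map_mxD map_mxM !lift_mxK YE subrr.
  by exists H; rewrite -HE addrC subrK.
(* The product of the two corrections carries [p^(2 r) = p^(r + 1) p^(r - 1)], where [0 < r] is
   used. *)
have {}BU : B *m U = fibre W *m (1%:M + p ^+ r *: V) +
    p ^+ r.+1 *: (H - p ^+ r.-1 *: ((D *m W)^l *m V)).
  rewrite BU -scalerN HE /fibre mulmxDr mulmx1 mulmxDl !scalerDr scalerN.
  rewrite -!scalemxAr -!scalemxAl !scalerA -exprD -exprSr.
  rewrite -exprD addSnnS prednK // -!addrA; congr (_ + _).
  by rewrite addrCA; congr (_ + _); congr (_ + _); rewrite addrCA addrN addr0.
have BUl := left_invertible_mul Uu Bl.
have fl : left_invertible (fibre W) by exact: left_invertible_addp.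
transitivity (lat r.+1 (B *m U)).
  apply: lat_eq => //; rewrite -[B *m U]addr0 -(scaler0 _ (p ^+ r.+1)).
  exact: lat_mulr.
by apply/esym/lat_eq => //; rewrite BU; exact: lat_mulr.
Qed.

End Fibre.

(** Every lattice of precision [r] has exactly one lift for each matrix [W]. As [P] is evaluated on
    the reduction, a closure condition at low precision is carried along. *)
Lemma has_card_fibre n m r (P : set (set 'rV[R]_n)) k : (0 < r)%N ->
  has_card [set M | is_lat m r M /\ P M] k ->
  has_card [set N | is_lat m r.+1 N /\ P (reduce r N)] (k * #|F| ^ ((n - m) * m)).
Proof.
move=> r0 [T [g [Tk ginj gP]]].
have h t : exists A : 'M[R]_(n, m), left_invertible A /\ g t = lat r A.
  by have /= [] := (gP (g t)).2 (ex_intro _ t erefl).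
pose A t := projT1 (cid (h t)).
have AP t : left_invertible (A t) /\ g t = lat r (A t) by rewrite /A; case: cid.
have c t : exists DX : 'M[F]_(n, n - m) * 'M[F]_(m + (n - m), n),
    row_mx (A t)^r DX.1 *m DX.2 = 1%:M /\ DX.2 *m row_mx (A t)^r DX.1 = 1%:M.
  have [D [X DX]] := row_full_complement ((left_invertibleP _).1 (AP t).1).
  by exists (D, X).
pose D t := (projT1 (cid (c t))).1; pose X t := (projT1 (cid (c t))).2.
have DX t : row_mx (A t)^r (D t) *m X t = 1%:M /\ X t *m row_mx (A t)^r (D t) = 1%:M.
  by rewrite /D /X; case: cid.
have red t W : reduce r (lat r.+1 (fibre r (A t) (D t) W)) = g t.
  rewrite (AP t).2 reduce_lat //; first exact: lat_addp.
  exact: left_invertible_addp (AP t).1.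
exists (T * 'M[F]_(n - m, m))%type, (fun u => lat r.+1 (fibre r (A u.1) (D u.1) u.2)).
split.
- by rewrite card_prod card_mx Tk.
- move=> [s V] [t W] /= e; have st : s = t.
    by apply: ginj; rewrite -(red s V) -(red t W) e.
  by subst t; rewrite (fibre_inj r0 (AP s).1 (DX s).2 e).
- move=> N; split=> [[[B [Bl ->]]]|[[t W] /= ->]]; last first.
    split; last by rewrite red; have /= [] := (gP (g t)).2 (ex_intro _ t erefl).
    by exists (fibre r (A t) (D t) W); split=> //; exact: left_invertible_addp (AP t).1.
  rewrite reduce_lat // => PB.
  have [t Bt] : exists t, lat r B = g t by apply/gP; split=> //; exists B.
  rewrite (AP t).2 in Bt.
  by have [W WE] := fibre_surj r0 (AP t).1 (DX t).1 Bl Bt; exists (t, W).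
Qed.

Lemma lat1E n m (A : 'M[R]_(n, m)) : lat 1 A = [set x | x^r \in left_ker A^r].
Proof.
apply/seteqP; split=> x /=.
  by case=> y xA; rewrite inE -map_mxM xA rho_pZ.
rewrite inE -map_mxM => /eqP/rho_mx_ker[y xA].
by exists y; rewrite expr1.
Qed.

Lemma has_card_lat1 n m : has_card [set M : set 'rV[R]_n | is_lat m 1 M]
  #|[set left_ker A | A in [set A : 'M[F]_(n, m) | row_full A]]%SET|.
Proof.
set K := (imset _ _).
exists {V : {set 'rV[F]_n} | V \in K}, 
  (fun V : {V : {set 'rV[F]_n} | V \in K} => [set x : 'rV_n | x^r \in sval V]).
split.
- by rewrite card_sig; apply: eq_card => V; rewrite inE.
- move=> [V VK] [W WK] /= e; apply: val_inj; apply/setP => x /=.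
  have /(congr1 (fun S => S x^l)) := e; rewrite /= lift_mxK => h.
  by apply/idP/idP; rewrite h.
- move=> M; split=> [[A [Al ->]]|[[V VK] ->]].
    have AK : left_ker A^r \in K.
      by apply/imsetP; exists A^r; rewrite // inE; apply/left_invertibleP.
    by exists (exist (fun V => V \in K) _ AK); rewrite lat1E.
  have /imsetP[A + VE] := VK; rewrite inE => fA; exists A^l.
  split; first by apply/left_invertibleP; rewrite lift_mxK.
  by rewrite lat1E lift_mxK /= VE.
Qed.

Lemma has_card_lat n m r : has_card [set M : set 'rV[R]_n | is_lat m r.+1 M]
  (#|[set left_ker A | A in [set A : 'M[F]_(n, m) | row_full A]]%SET| *
   (#|F| ^ ((n - m) * m)) ^ r)%N.
Proof.
elim: r => [|r IHr]; first by rewrite expn0 muln1; exact: has_card_lat1.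
rewrite expnSr mulnA.
have -> : [set M : set 'rV[R]_n | is_lat m r.+2 M] =
    [set M | is_lat m r.+2 M /\ [set: set 'rV[R]_n] (reduce r.+1 M)].
  by apply/seteqP; split=> M //= [].
apply: has_card_fibre => //; set P := (X in has_card X _).
by rewrite (_ : P = [set M | is_lat m r.+1 M]) //; apply/seteqP; split=> M //= [].
Qed.

Lemma has_card_lat_reduce n m l r (P : set (set 'rV[R]_n)) k : (0 < l)%N ->
  has_card [set M | is_lat m l M /\ P M] k ->
  has_card [set N | is_lat m (r + l) N /\ P (reduce l N)]
    (k * (#|F| ^ ((n - m) * m)) ^ r).
Proof.
move=> l0 Pk; elim: r => [|r IHr].
  rewrite expn0 muln1; have -> // : [set N | is_lat m (0 + l) N /\ P (reduce l N)] =
    [set M | is_lat m l M /\ P M].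
  by apply/seteqP; split=> _ [[A [Al ->]]] /=; rewrite add0n ?reduce_lat // => PA;
    split=> //; exists A.
rewrite expnSr mulnA.
have rl0 : (0 < r + l)%N by rewrite addn_gt0 l0 orbT.
have := has_card_fibre (P := P \o @reduce n l) rl0 IHr; congr (has_card _ _).
have key (A : 'M[R]_(n, m)) : left_invertible A ->
    reduce l (reduce (r + l) (lat (r + l).+1 A)) = reduce l (lat (r + l).+1 A).
  by move=> Al; rewrite (reduce_lat (leqnSn _) Al) !reduce_lat ?leqW ?leq_addl.
by apply/seteqP; split=> _ [[A [Al ->]]] /=; rewrite key // => PA; split=> //;
  exists A.
Qed.

(** * Multiplicatively closed lattices *)

(* Coordinates are numbered from 1, with a coordinate 0 that is constantly 0. *)
Definition coord n (x : 'rV[R]_n) (i : nat) : R :=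
  if i is j.+1 then oapp (x 0) 0 (insub j) else 0.

Lemma coordS n (x : 'rV[R]_n) (j : 'I_n) : coord x j.+1 = x 0 j.
Proof. by rewrite /coord valK. Qed.

Lemma coordD n (x y : 'rV[R]_n) i : coord (x + y) i = coord x i + coord y i.
Proof.
by case: i => [|i] /=; rewrite ?addr0 //; case: insub => [j|] /=; rewrite ?mxE ?addr0.
Qed.

Lemma coordZ n c (x : 'rV[R]_n) i : coord (c *: x) i = c * coord x i.
Proof.
by case: i => [|i] /=; rewrite ?mulr0 //; case: insub => [j|] /=; rewrite ?mxE ?mulr0.
Qed.

Lemma coord_rmul n (x y : 'rV[R]_n) i : coord (rmul x y) i = coord x i * coord y i.
Proof.
by case: i => [|i] /=; rewrite ?mulr0 //; case: insub => [j|] /=; rewrite ?mxE ?mulr0.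
Qed.

Lemma coord_sum n (x : 'rV[R]_n) i :
  \sum_(j < n) x 0 j * (j.+1 == i)%:R = coord x i.
Proof.
case: i => [|i] /=; first by rewrite big1 // => j _; rewrite mulr0.
case: insubP => [j _ ji|ni] /=; last first.
  rewrite big1 // => j _; rewrite eqSS; case: eqP => [e|]; rewrite ?mulr0 //.
  by rewrite -e ltn_ord in ni.
rewrite (bigD1 j) //= eqSS ji eqxx mulr1 big1 ?addr0 // => k kj.
by rewrite eqSS -ji val_eqE (negPf kj) mulr0.
Qed.

(** As coordinate 0 is constantly zero, its block collects the coordinates that vanish modulo [p^r];
    this is how lattices without the all-one vector arise. *)
Definition block_lat n r (s : seq nat) : set 'rV[R]_n :=
  [set x | forall i, (i <= n)%N ->
     exists b, coord x i - coord x (nth 0%N s i) = p ^+ r * b].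

Section Blocks.
Variables (n : nat) (s : seq nat).
Hypothesis s_part : s \in partition_seqs n.+1.

Lemma part_le i : (i <= n)%N -> (nth 0 s i <= i)%N.
Proof. by move=> li; have [_ /(_ i li)[]] := partition_seqsP _ _ s_part. Qed.

Lemma part_idem i : (i <= n)%N -> nth 0%N s (nth 0%N s i) = nth 0%N s i.
Proof. by move=> li; have [_ /(_ i li)[]] := partition_seqsP _ _ s_part. Qed.

Lemma part0 : nth 0%N s 0 = 0%N.
Proof. by apply/eqP; rewrite -leqn0 part_le. Qed.

(** There is one congruence for each coordinate that is not least in its block. Point 0 is always
    least, so it adds to neither side of this count. *)
Lemma card_non_least :
  #|[pred j : 'I_n | nth 0%N s j.+1 != j.+1]| = (n.+1 - nblocks s)%N.
Proof.
have sz := size_partition_seqs s_part.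
suff e : (nblocks s + #|[pred j : 'I_n | nth 0%N s j.+1 != j.+1]| = n.+1)%N.
  by rewrite -[in RHS]e addKn.
rewrite /nblocks sz /= part0 eqxx add1n addSn; congr _.+1.
rewrite (iotaDl 1 0) count_map -val_enum_ord count_map -[RHS](card_ord n).
rewrite -(cardC [pred j : 'I_n | nth 0%N s j.+1 == j.+1]); congr (_ + _)%N.
  by rewrite cardE enumT /enum_mem size_filter.
Qed.

Lemma block_latE : exists B : 'M[R]_(n, n.+1 - nblocks s),
  left_invertible B /\ forall r, block_lat r s = lat r B.
Proof.
rewrite -card_non_least; set N := [pred j : 'I_n | _].
pose v (c : 'I_#|N|) := enum_val c.
have vN c : nth 0%N s (v c).+1 != (v c).+1 by exact: enum_valP c.
pose B : 'M[R]_(n, #|N|) := \matrix_(i, c)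
  ((i == v c)%:R - (i.+1 == nth 0%N s (v c).+1)%:R).
exists B; split.
  (* Selecting the rows [v c] gives a left inverse: these coordinates are not least in their blocks,
     so the negative entries of [B] miss those rows. *)
  exists (\matrix_(c, i) (i == v c)%:R); apply/matrixP => c d.
  rewrite !mxE (bigD1 (v c)) //= !mxE eqxx mul1r big1 ?addr0; last first.
    by move=> i; rewrite mxE => /negPf ->; rewrite mul0r.
  rewrite (inj_eq enum_val_inj); case: ((v c).+1 =P _) => [e|_]; rewrite ?subr0 //.
  by have := vN c; rewrite e part_idem ?eqxx // ltn_ord.
have xB (x : 'rV_n) c : (x *m B) 0 c = coord x (v c).+1 - coord x (nth 0%N s (v c).+1).
  rewrite mxE -coord_sum -[in X in _ - X]coord_sum -sumrB; apply: eq_bigr => i _.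
  by rewrite mxE mulrBr eqSS.
move=> r; apply/seteqP; split=> x.
  move=> xs; have h c : exists b, (x *m B) 0 c = p ^+ r * b.
    by rewrite xB; apply: xs; rewrite ltn_ord.
  exists (\row_c projT1 (cid (h c))); apply/rowP => c.
  by rewrite [RHS]mxE [in RHS]mxE; case: cid.
move=> [y xy] i li; have [->|ne] := eqVneq (nth 0%N s i) i.
  by exists 0; rewrite subrr mulr0.
case: i li ne => [|i] li ne; first by rewrite part0 in ne.
have Ni : Ordinal li \in N by [].
exists (y 0 (enum_rank_in Ni (Ordinal li))).
have := congr1 (fun z : 'rV_#|N| => z 0 (enum_rank_in Ni (Ordinal li))) xy.
by rewrite xB [X in _ = X -> _]mxE /v enum_rankK_in.
Qed.

Lemma block_lat_mulclosed r : mulclosed (block_lat r s : set 'rV_n).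
Proof.
move=> x y xs ys i li; have [b xb] := xs i li; have [c yc] := ys i li.
exists (coord x i * c + b * coord y (nth 0%N s i)).
rewrite !coord_rmul mulrDr mulrCA -yc mulrA -xb mulrBr mulrBl.
by rewrite addrA subrK.
Qed.

Definition block_ind (b : nat) : 'rV[R]_n := \row_j (nth 0%N s j.+1 == b)%:R.

Lemma coord_block_ind b i : (0 < b)%N -> (i <= n)%N ->
  coord (block_ind b) i = (nth 0%N s i == b)%:R.
Proof.
case: i => [|i] b0 li; first by rewrite part0 eq_sym -[b]prednK.
by rewrite (coordS _ (Ordinal li)) mxE.
Qed.

Lemma block_ind_in r b : (0 < b)%N -> block_lat r s (block_ind b).
Proof.
move=> b0 i li; exists 0; rewrite !coord_block_ind ?part_idem // ?subrr ?mulr0 //.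
exact: leq_trans (part_le li) li.
Qed.

End Blocks.

(** The indicator of a block of [t] lies in the lattice, hence is constant modulo [p] on the blocks
    of [s]. So [i] and its [s]-representative have the same [t]-representative, which is therefore
    at most the [s]-representative; symmetry gives equality. *)
Lemma block_lat_inj n r s t : (0 < r)%N ->
  s \in partition_seqs n.+1 -> t \in partition_seqs n.+1 ->
  block_lat r s = block_lat r t :> set 'rV_n -> s = t.
Proof.
move=> r0; suff le s' t' i : s' \in partition_seqs n.+1 -> t' \in partition_seqs n.+1 ->
    block_lat r s' = block_lat r t' :> set 'rV_n -> (i <= n)%N ->
    (nth 0 t' i <= nth 0 s' i)%N.
  move=> sP tP e; apply: (@eq_from_nth _ 0%N).
    by rewrite !(size_partition_seqs sP, size_partition_seqs tP).
  rewrite (size_partition_seqs sP) => i li.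
  by apply/eqP; rewrite eqn_leq !le.
move=> sP tP e li; have li' := leq_trans (part_le sP li) li.
suff <- : nth 0%N t' (nth 0%N s' i) = nth 0%N t' i by exact: (part_le tP li').
have sep b : (0 < b)%N -> (nth 0%N t' i == b) = (nth 0%N t' (nth 0%N s' i) == b).
  move=> b0; have := block_ind_in tP r b0; rewrite -e => /(_ i li)[c].
  rewrite !coord_block_ind // => /(congr1 rho).
  rewrite rmorphM rmorphXn rho_p expr0n -[r]prednK //= mul0r rmorphB !rmorph_nat.
  case: (nth 0%N t' i == b); case: (nth 0%N t' _ == b); rewrite //= ?subr0 ?sub0r;
    by move=> /eqP; rewrite ?oppr_eq0 oner_eq0.
case: (posnP (nth 0%N t' i)) => [ti0|/sep]; last by rewrite eqxx => /esym/eqP.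
case: (posnP (nth 0%N t' (nth 0%N s' i))) => [->|/sep]; first by rewrite ti0.
by rewrite eqxx => /eqP.
Qed.

Lemma row_congr n (c : R) (x y : 'rV[R]_n) :
  (forall j, exists w, x 0 j - y 0 j = c * w) -> exists u, x = y + c *: u.
Proof.
move=> h; exists (\row_j projT1 (cid (h j))); apply/rowP => j; rewrite !mxE.
by case: cid => w /= <-; rewrite addrC subrK.
Qed.

Lemma lat_sum n m r (A : 'M[R]_(n, m)) (I : finType) (Q : pred I) (x : I -> 'rV_n) :
  (forall i, Q i -> lat r A (x i)) -> lat r A (\sum_(i | Q i) x i).
Proof.
move=> xA; apply: (big_ind (lat r A)) => //; last by move=> *; exact: latD.
by apply: ker_lat; rewrite mul0mx.
Qed.

(** * From closed lattices to partitions *)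

Section ClosedLattice.
Variables (n m r : nat) (A : 'M[R]_(n, m)).
Hypotheses (r_gt0 : (0 < r)%N) (Al : left_invertible A).
Hypothesis A_closed : mulclosed (lat r A).

(** Two coordinates are identified when no vector of the lattice separates them modulo [p]; the
    classes become the blocks. *)
Let same (i j : nat) : bool :=
  `[< forall x, lat r A x -> rho (coord x i) = rho (coord x j) >].

Let sameP i j :
  reflect (forall x, lat r A x -> rho (coord x i) = rho (coord x j)) (same i j).
Proof. exact: asboolP. Qed.

Let same_refl i : same i i.
Proof. exact/sameP. Qed.

Let same_left i j : same i j -> same i =1 same j.
Proof.
move=> /sameP ij k; apply/sameP/sameP => h x xA; last by rewrite ij // h.
by rewrite -ij // h.
Qed.

Let least (i : nat) := find (same i) (iota 0 n.+1).

Let nth_iota0 i : (i <= n)%N -> nth 0%N (iota 0 n.+1) i = i.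
Proof. by move=> li; rewrite nth_iota. Qed.

Let least_le i : (i <= n)%N -> (least i <= i)%N.
Proof.
move=> li; rewrite leqNgt; apply/negP => /(before_find 0%N).
by rewrite nth_iota0 // same_refl.
Qed.

Let least_same i : (i <= n)%N -> same i (least i).
Proof.
move=> li; have := least_le li => le.
rewrite -[X in same i X](nth_iota0 (leq_trans le li)).
apply: nth_find; apply/hasP; exists i => //; by rewrite mem_iota.
Qed.

Let least_eq i j : (i <= n)%N -> (j <= n)%N -> same i j = (least i == least j).
Proof.
move=> li lj; apply/idP/eqP => [ij|e]; first exact/eq_find/same_left.
by rewrite (same_left (least_same li)) e -(same_left (least_same lj)).
Qed.

Let s := mkseq least n.+1.

Let nth_s i : (i <= n)%N -> nth 0%N s i = least i.
Proof. by move=> li; rewrite nth_mkseq. Qed.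

Let s_part : s \in partition_seqs n.+1.
Proof.
apply/partition_seqsP; split; first by rewrite size_mkseq.
move=> i li; rewrite nth_s // least_le //; split=> //.
have ln : (least i <= n)%N by exact: leq_trans (least_le li) li.
by rewrite nth_s //; apply/eqP; rewrite -least_eq // -(same_left (least_same li)).
Qed.

(* Multiplying [y] by [x - x_j] keeps the product in the lattice, which need not
   contain the constant vector. *)
Let separate b (l : seq nat) : (0 < b <= n)%N -> nth 0%N s b = b ->
  (forall j, j \in l -> ~~ same b j) ->
  exists y, [/\ lat r A y, rho (coord y b) = 1 &
                forall j, j \in l -> rho (coord y j) = 0].
Proof.
move=> /andP[b0 bn] sb; rewrite nth_s // in sb.
have sepP j : ~~ same b j ->
    exists2 x, lat r A x & rho (coord x b) - rho (coord x j) != 0.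
  move=> /sameP/existsNP[x /not_implyP[xA /eqP ne]].
  by exists x; rewrite // subr_eq0.
elim: l => [|j l IHl] nl.
  (* A least element [b > 0] is not identified with 0, so some vector of the lattice has coordinate
     [b] nonzero modulo [p]; scaling makes it 1. *)
  have [|x xA] := sepP 0%N.
    by rewrite least_eq // sb; apply: contraTneq b0 => ->; rewrite -leqNgt least_le.
  rewrite [coord x 0]/= rmorph0 subr0 => xb.
  exists (lift (rho (coord x b))^-1 *: x); split=> //; first exact: lat_scale.
  by rewrite coordZ rmorphM liftK mulVf.
have [|y [yA yb yl]] := IHl; first by move=> k kl; apply: nl; rewrite inE kl orbT.
have [|x xA xbj] := sepP j; first by apply: nl; rewrite inE eqxx.
set d := _ - _ in xbj.
exists (lift d^-1 *: (rmul x y - coord x j *: y)).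
have yE k : rho (coord (lift d^-1 *: (rmul x y - coord x j *: y)) k) =
    d^-1 * ((rho (coord x k) - rho (coord x j)) * rho (coord y k)).
  rewrite coordZ rmorphM liftK -scaleNr coordD coordZ coord_rmul.
  by rewrite mulNr -mulrBl rmorphM rmorphB.
split.
- apply: lat_scale; apply: latD; first exact: A_closed.
  by rewrite -scaleNr; exact: lat_scale.
- by rewrite yE yb mulr1 mulVf.
- move=> k; rewrite inE yE => /orP[/eqP ->|/yl ->]; last by rewrite !mulr0.
  by rewrite subrr mul0r mulr0.
Qed.

(** Idempotent lifting: [separate] gives the indicator of a block modulo [p], and each step gains a
    power of [p] through a polynomial in [y] that has no constant term and so stays in the
    lattice. *)
Let block_ind_mod b k : (0 < b <= n)%N -> nth 0%N s b = b ->
  exists y u, lat r A y /\ y = block_ind n s b + p ^+ k.+1 *: u.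
Proof.
move=> bn sb; elim: k => [|k [y [u [yA yE]]]].
  have [|y [yA yb yl]] := @separate b [seq j <- iota 0 n.+1 | ~~ same b j] bn sb.
    by move=> j; rewrite mem_filter => /andP[].
  exists y; have [|u yu] := @rho_mx_ker _ _ (y - block_ind n s b).
    apply/rowP => j; rewrite !mxE rmorphB rmorph_nat -(coordS y).
    have lj : (j.+1 <= n)%N by [].
    have -> : (nth 0%N s j.+1 == b) = same b j.+1.
      have /andP[_ lb] := bn.
      by rewrite least_eq // -!nth_s // sb eq_sym.
    case: (boolP (same b j.+1)) => [/sameP h|nj]; first by rewrite -h // yb subrr.
    by rewrite yl ?subrr // mem_filter nj mem_iota.
  by exists u; rewrite expr1 -yu addrC subrK.
(* The polynomial 2y^2 - y^4 vanishes to order 2 at 0 and 2y^2 - y^4 - 1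
   vanishes to order 2 at 1. *)
pose z := rmul y y; exists (2%:R *: z - rmul z z).
have h j : exists w, (2%:R *: z - rmul z z) 0 j - block_ind n s b 0 j = p ^+ k.+2 * w.
  have pk x : exists w, (p ^+ k.+1 * u 0 j) ^+ 2 * x = p ^+ k.+2 * w.
    exists (p ^+ k * (u 0 j) ^+ 2 * x).
    by rewrite exprMn -exprM !mulrA -exprD; do 3!congr (_ * _); congr (_ ^+ _); lia.
  have {yE} yj : y 0 j = block_ind n s b 0 j + p ^+ k.+1 * u 0 j by rewrite yE !mxE.
  rewrite !mxE yj !mxE; set t := p ^+ k.+1 * u 0 j in pk *.
  case: (_ == b) => /=.
    have [w wE] := pk (- (1 + (1 + t)) ^+ 2); exists w; rewrite -wE.
    have -> : t ^+ 2 * - (1 + (1 + t)) ^+ 2 = - ((1 + t) * (1 + t) - 1) ^+ 2.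
      rewrite mulrN -exprMn; congr (- _ ^+ 2).
      by rewrite -expr2 subr_sqr_1 [1 + (1 + t)]addrC (addrC 1 t) addrK.
    by rewrite sqrrB1 !opprD opprK -expr2 mulr_natl [- _ + _]addrC.
  have [w wE] := pk (2%:R - t ^+ 2); exists w; rewrite -wE.
  by rewrite subr0 add0r -expr2 mulrBr [2%:R * _]mulrC expr2.
have [u' zE] := row_congr h; exists u'; split=> //.
apply: latD; first by apply: lat_scale; exact: A_closed.
by rewrite -scaleN1r; apply: lat_scale; do 2!apply: A_closed => //.
Qed.

Let block_ind_lat b : (0 < b <= n)%N -> nth 0%N s b = b -> lat r A (block_ind n s b).
Proof.
move=> bn sb; have [y [u [yA yE]]] := block_ind_mod r.-1 bn sb.
rewrite prednK // in yE; have -> : block_ind n s b = y + p ^+ r *: - u.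
  by rewrite yE scalerN addrK.
by apply: latD => //; exact: latZ.
Qed.

Let block_lat_sub : block_lat r s `<=` lat r A.
Proof.
(* Modulo [p^r], [x] is the combination of block indicators weighted by its coordinates at the least
   elements; the block of 0 contributes nothing. *)
move=> x xs; pose z : 'rV_n :=
  \sum_(b : 'I_n | nth 0%N s b.+1 == b.+1) x 0 b *: block_ind n s b.+1.
have zE j : z 0 j = coord x (nth 0%N s j.+1).
  rewrite summxE -coord_sum big_mkcond; apply: eq_bigr => b _.
  rewrite !mxE (eq_sym (nth 0%N s j.+1)).
  case: (nth 0%N s b.+1 =P b.+1) => // ne.
  case: (b.+1 =P nth 0%N s j.+1) => [e|]; rewrite ?mulr0 //.
  by case: ne; rewrite e (part_idem s_part).
have h j : exists b, x 0 j - z 0 j = p ^+ r * b.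
  by rewrite zE -coordS; apply: xs.
have [u ->] := row_congr h.
apply: latD; last exact: latZ.
by apply: lat_sum => b /eqP sb; apply: lat_scale; apply: block_ind_lat;
  rewrite ?ltn_ord.
Qed.

(** The block lattice lies in the given one at precision [r], while the opposite inclusion is
    immediate at precision 1. Together they equate the two widths, after which [lat_eq] turns the
    first inclusion into an equality. *)
Lemma closed_lat_block : exists t, [/\ t \in partition_seqs n.+1,
  (n.+1 - nblocks t = m)%N & lat r A = block_lat r t].
Proof.
exists s; have [B [Bl BE]] := block_latE s_part.
have sBA : lat r B `<=` lat r A by rewrite -BE; exact: block_lat_sub.
have sAB : lat 1 A `<=` lat 1 B.
  move=> _ /(lat_decomp Al)[x' [u [-> x'A]]]; apply: latD; last exact: latZ.
  rewrite -BE => i li.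
  have /rho_ker[b bE] : rho (coord x' i - coord x' (nth 0%N s i)) = 0.
    rewrite rmorphB nth_s //; apply/eqP; rewrite subr_eq0; apply/eqP.
    by have /sameP := least_same li; apply; exact: ker_lat.
  by exists b; rewrite expr1 mulrC.
have em : (n.+1 - nblocks s = m)%N.
  by apply/eqP; rewrite eqn_leq (lat_width_le _ Al Bl sAB) //
    (lat_width_le _ Bl Al sBA).
split=> //; rewrite BE; move: B Bl sBA {BE sAB}; rewrite em => B Bl sBA.
exact/esym/lat_eq.
Qed.

End ClosedLattice.

Lemma has_card_closed_lat n m r : (0 < r)%N -> (m <= n)%N ->
  has_card [set M : set 'rV[R]_n | is_lat m r M /\ mulclosed M]
    (count (fun s => nblocks s == (n - m).+1) (partition_seqs n.+1)).
Proof.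
move=> r0 mn; set Q := fun s : seq nat => _.
exists (seq_sub [seq s <- partition_seqs n.+1 | Q s]), (fun s => block_lat r (val s)).
split.
- by rewrite card_seq_sub ?size_filter // filter_uniq // uniq_partition_seqs.
- move=> [s sP] [t tP] /= e; apply: val_inj => /=; move: sP tP.
  rewrite !mem_filter => /andP[_ sP] /andP[_ tP]; exact: (block_lat_inj r0 sP tP e).
- move=> M; split=> [[[A [Al ->]] Ac]|[[s sQ] /= ->]].
    have [s [sP sm ->]] := closed_lat_block r0 Al Ac.
    have sQ : s \in [seq s <- partition_seqs n.+1 | Q s].
      have := nblocks_le s; rewrite (size_partition_seqs sP) mem_filter sP andbT /Q.
      lia.
    by exists (SeqSub sQ).
  move: (sQ); rewrite mem_filter => /andP[/eqP sm sP].
  split; last exact: block_lat_mulclosed.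
  have := block_latE sP; have -> : (n.+1 - nblocks s = m)%N by lia.
  by case=> B [Bl BE]; exists B; rewrite BE.
Qed.

(** * Submodules of prescribed elementary type *)

(** If [r <= r0] the closure condition is void and [r.-1] lifts start from precision 1. Otherwise
    the condition lives at precision [r - r0], and [r0] lifts remain. *)
Lemma has_card_scaled_closed n m r0 r : (0 < r)%N -> (m <= n)%N ->
  has_card [set M : set 'rV[R]_n | is_lat m r M /\
      forall x y, M x -> M y -> M (p ^+ r0 *: rmul x y)]
    (if (r <= r0)%N then
       #|[set left_ker A | A in [set A : 'M[F]_(n, m) | row_full A]]%SET| *
         (#|F| ^ ((n - m) * m)) ^ r.-1
     else count (fun s => nblocks s == (n - m).+1) (partition_seqs n.+1) *
         (#|F| ^ ((n - m) * m)) ^ r0)%N.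
Proof.
move=> r_gt0 mn; have [le_r|lt_r] := leqP r r0.
  have := has_card_lat n m r.-1; rewrite prednK //; congr (has_card _ _).
  apply/seteqP; split=> M /=; last by case.
  case=> A [Al ->].
  split; first by exists A.
  move: le_r => /eqP le_r; apply/(mulclosed_scale r0 r Al).
  by rewrite le_r => x y _ _; exact: lat0.
have l0 : (0 < r - r0)%N by rewrite subn_gt0.
have := has_card_lat_reduce r0 l0 (has_card_closed_lat l0 mn).
rewrite subnKC ?(ltnW lt_r) //; congr (has_card _ _).
apply/seteqP; split=> _ [[A [Al ->]]] /= H; (split; first by exists A).
  by move: H; rewrite reduce_lat ?leq_subr // => /(mulclosed_scale r0 r Al).
by rewrite reduce_lat ?leq_subr //; exact/(mulclosed_scale r0 r Al).
Qed.

(** * Translation between row vectors and elements of the free module *)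

Definition rowf n (x : free_mod R n) : 'rV[R]_n := \row_i x i.
Definition frow n (x : 'rV[R]_n) : free_mod R n := [ffun i => x 0 i].

Lemma rowfK n : cancel (@rowf n) (@frow n).
Proof. by move=> x; apply/ffunP => i; rewrite ffunE mxE. Qed.

Lemma frowK n : cancel (@frow n) (@rowf n).
Proof. by move=> x; apply/rowP => i; rewrite mxE ffunE. Qed.

Lemma rowfD n (x y : free_mod R n) : rowf (x + y) = rowf x + rowf y.
Proof. by apply/rowP => i; rewrite !mxE ffunE. Qed.

Lemma rowfZ n c (x : free_mod R n) : rowf (c *: x) = c *: rowf x.
Proof. by apply/rowP => i; rewrite !mxE ffunE. Qed.

Lemma rowfB n (x y : free_mod R n) : rowf (x - y) = rowf x - rowf y.
Proof. by rewrite rowfD -scaleN1r rowfZ scaleN1r. Qed.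

Lemma rowfM n (x y : free_mod R n) : rowf (x * y) = rmul (rowf x) (rowf y).
Proof. by apply/rowP => i; rewrite !mxE ffunE. Qed.

Lemma quotmod_row n m c
    (psi : free_mod R n -> {ffun 'I_m -> quotmod (principal_ideal c)}) :
  (forall x y, psi (x + y) = psi x + psi y) ->
  (forall a x, psi (a *: x) = a *: psi x) ->
  exists A : 'M[R]_(n, m), forall x j,
    psi x j = \pi_(quotmod (principal_ideal c))%qT ((rowf x *m A) 0 j).
Proof.
move=> psiD psiZ.
have psi0 : psi 0 = 0 by rewrite -(scale0r (0 : free_mod R n)) psiZ scale0r.
exists (\matrix_(i, j) repr (psi (frow (delta_mx 0 i)) j)) => x j.
have xE : x = \sum_i x i *: frow (delta_mx 0 i).
  apply/ffunP => k; rewrite sum_ffunE (bigD1 k) //= !ffunE !mxE !eqxx.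
  rewrite big1 ?addr0 => [|i ik]; first by rewrite -[LHS]mulr1.
  by rewrite !ffunE !mxE eq_sym (negPf ik) andbF scaler0.
rewrite {1}xE (big_morph _ psiD psi0) sum_ffunE mxE.
rewrite (big_morph _ (@quotmod_piD _ _ _) (@quotmod_pi0 _ _ _)).
apply: eq_bigr => i _; rewrite psiZ ffunE !mxE.
by rewrite -[_ * _]/(x i *: (_ : R^o)) quotmod_piZ reprK.
Qed.

Lemma quotmod_pi_row n c (x : 'rV[R]_n) :
  (forall j, \pi_(quotmod (principal_ideal c))%qT (x 0 j) = 0) <->
  exists y, x = c *: y.
Proof.
split=> [h|[y ->] j].
  have [|y yE] := @row_congr n c x 0; last by exists y; rewrite yE add0r.
  move=> j; have /quotmod_pi_eq0/principalP[b ->] := h j.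
  by exists b; rewrite mxE subr0 mulrC.
by apply/quotmod_pi_eq0/principalP; exists (y 0 j); rewrite mxE mulrC.
Qed.

Lemma left_invertible_rows n m k (A : 'M[R]_(n, m)) : (0 < k)%N ->
  (forall i, exists x y, x *m A = row i 1%:M + p ^+ k *: y) -> left_invertible A.
Proof.
move=> k0 h; have {h}h i : exists x, x *m A^r = row i 1%:M.
  have [x [y xA]] := h i; exists x^r.
  by rewrite -map_mxM xA rho_addp // map_row map_mx1.
apply/left_invertibleP/row_fullP; exists (\matrix_i projT1 (cid (h i))).
by apply/row_matrixP => i; rewrite row_mul rowK; case: cid.
Qed.

Lemma left_invertible_square n m (A : 'M[R]_(n, m)) : n = m -> left_invertible A ->
  exists G, G *m A = 1%:M /\ A *m G = 1%:M.
Proof. by move=> e; subst m => -[G GA]; exists G; split=> //; exact: mulmx1C. Qed.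

Definition scaled_lat n m r0 r (A : 'M[R]_(n, m)) (L : submodClosed (free_mod R n)) :=
  forall x, x \in L <-> exists y, rowf x = p ^+ r0 *: y /\ lat r A y.

(** The two components of the isomorphism lift to matrices [A] and [B], and [L] is cut out by
    [x A = 0] modulo [p^(r0 + r)] and [x B = 0] modulo [p^r0]. Once elements of [L] are known to be
    divisible by [p^r0], the second condition is automatic. *)
Lemma isomorphic_scaled_lat n m r0 r (L : submodClosed (free_mod R n)) :
  (0 < r)%N -> (m <= n)%N ->
  lmod_isomorphic (quotmod L) (elementary_type p n m r0 r) ->
  exists A : 'M[R]_(n, m), left_invertible A /\ scaled_lat r0 r A L.
Proof.
move=> r_gt0 mn [phi [phi' phiK phi'K]].
pose Phi (x : free_mod R n) : elementary_type p n m r0 r := phi (\pi_(quotmod L)%qT x).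
have PhiD x y : Phi (x + y) = Phi x + Phi y by rewrite /Phi quotmod_piD linearD.
have PhiZ a x : Phi (a *: x) = a *: Phi x by rewrite /Phi quotmod_piZ linearZ.
have [|a x|A AE] := @quotmod_row n m (p ^+ (r0 + r)) (fun x => (Phi x).1).
- by move=> x y; rewrite PhiD.
- by rewrite PhiZ.
have [|a x|B BE] := @quotmod_row n (n - m) (p ^+ r0) (fun x => (Phi x).2).
- by move=> x y; rewrite PhiD.
- by rewrite PhiZ.
have inL x : x \in L <-> (exists y, rowf x *m A = p ^+ (r0 + r) *: y) /\
    (exists z, rowf x *m B = p ^+ r0 *: z).
  rewrite -!quotmod_pi_row -quotmod_pi_eq0; split=> [x0|[xA xB]].
    have Phi0 : Phi x = 0 by rewrite /Phi x0 linear0.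
    by split=> j; rewrite -?AE -?BE Phi0 ffunE.
  apply: (can_inj phiK); rewrite linear0 -[LHS]/(Phi x) [Phi x]surjective_pairing.
  by congr (_, _); apply/ffunP => j; rewrite ?AE ?BE ?xA ?xB ffunE.
have surj (c : 'rV_m) (d : 'rV_(n - m)) : exists x y z,
    x *m A = c + p ^+ (r0 + r) *: y /\ x *m B = d + p ^+ r0 *: z.
  pose e : elementary_type p n m r0 r :=
    ([ffun j => \pi_(quotmod (principal_ideal (p ^+ (r0 + r))))%qT (c 0 j)],
     [ffun j => \pi_(quotmod (principal_ideal (p ^+ r0)))%qT (d 0 j)]).
  pose x := repr (phi' e).
  have Phix : Phi x = e by rewrite /Phi reprK phi'K.
  have [y yE] : exists y, rowf x *m A - c = p ^+ (r0 + r) *: y.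
    apply/quotmod_pi_row => j; rewrite [_ 0 j]mxE [(- c) 0 j]mxE.
    by rewrite quotmod_piB -AE Phix ffunE subrr.
  have [z zE] : exists z, rowf x *m B - d = p ^+ r0 *: z.
    apply/quotmod_pi_row => j; rewrite [_ 0 j]mxE [(- d) 0 j]mxE.
    by rewrite quotmod_piB -BE Phix ffunE subrr.
  by exists (rowf x), y, z; rewrite -yE -zE; split; rewrite addrC subrK.
have Al : left_invertible A.
  apply: (@left_invertible_rows _ _ (r0 + r)); first by rewrite addn_gt0 r_gt0 orbT.
  by move=> i; have [x [y [z [xA _]]]] := surj (row i 1%:M) 0; exists x, y.
have div x : x \in L -> exists y, rowf x = p ^+ r0 *: y.
  (* For [r0 = 0] divisibility is trivial; for [r0 > 0] surjectivity modulo [p] makes the square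
     matrix [[A B]] invertible. *)
  case: (posnP r0) => [->|r0_gt0]; first by exists (rowf x); rewrite scale1r.
  move=> /inL[[y xA] [z xB]].
  have ABl : left_invertible (row_mx A B).
    apply: left_invertible_rows r0_gt0 _ => i.
    have [u [v [w [uA uB]]]] := surj (lsubmx (row i 1%:M)) (rsubmx (row i 1%:M)).
    exists u, (row_mx (p ^+ r *: v) w).
    by rewrite mul_mx_row uA uB scale_row_mx scalerA -exprD -add_row_mx hsubmxK.
  have [|G [_ GAB]] := left_invertible_square _ ABl; first by rewrite subnKC.
  exists (row_mx (p ^+ r *: y) z *m G).
  rewrite scalemxAl scale_row_mx scalerA -exprD -xA -xB -mul_mx_row.
  by rewrite -mulmxA GAB mulmx1.
exists A; split=> // x; split=> [xL|[y [xE [z yA]]]].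
  have [y xE] := div x xL; exists y; split=> //.
  have /inL[[z xA] _] := xL; exists z.
  by move: xA; rewrite xE -scalemxAl exprD -scalerA => /scale_pI.
apply/inL; rewrite xE -!scalemxAl; split; last by exists (y *m B).
by exists z; rewrite yA scalerA exprD.
Qed.

(** [A] is completed to an invertible [[A B]]; reducing [x A] and [x B] gives a surjection with
    kernel [L]. *)
Lemma scaled_lat_isomorphic n m r0 r (A : 'M[R]_(n, m))
    (L : submodClosed (free_mod R n)) :
  (m <= n)%N -> left_invertible A -> scaled_lat r0 r A L ->
  lmod_isomorphic (quotmod L) (elementary_type p n m r0 r).
Proof.
move=> mn Al LA.
have [D [X [_ XD]]] := row_full_complement ((left_invertibleP _).1 Al).
pose B := D^l.
have ABl : left_invertible (row_mx A B).
  by apply/left_invertibleP/row_fullP; exists X; rewrite map_row_mx lift_mxK.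
have [|G [GAB ABG]] := left_invertible_square _ ABl; first by rewrite subnKC.
pose Phi (x : free_mod R n) : elementary_type p n m r0 r :=
  ([ffun j => \pi_(quotmod (principal_ideal (p ^+ (r0 + r))))%qT ((rowf x *m A) 0 j)],
   [ffun j => \pi_(quotmod (principal_ideal (p ^+ r0)))%qT ((rowf x *m B) 0 j)]).
have PhiD x y : Phi (x + y) = Phi x + Phi y.
  by congr (_, _); apply/ffunP => j; rewrite !ffunE rowfD mulmxDl mxE quotmod_piD.
have PhiZ a x : Phi (a *: x) = a *: Phi x.
  congr (_, _); apply/ffunP => j; rewrite !ffunE rowfZ -scalemxAl mxE;
  by rewrite -[_ * _]/(a *: (_ : R^o)) quotmod_piZ.
have Phi0 x : Phi x = 0 <-> x \in L.
  have -> : Phi x = 0 <-> (exists y, rowf x *m A = p ^+ (r0 + r) *: y) /\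
      (exists z, rowf x *m B = p ^+ r0 *: z).
    rewrite -!quotmod_pi_row; split=> [[xA xB]|[xA xB]].
      split=> j.
        by have := congr1 (fun f : {ffun _ -> _} => f j) xA; rewrite !ffunE.
      by have := congr1 (fun f : {ffun _ -> _} => f j) xB; rewrite !ffunE.
    by congr (_, _); apply/ffunP => j; rewrite !ffunE ?xA ?xB.
  rewrite LA; split=> [[[y xA] [z xB]]|[y [-> [z yA]]]]; last first.
    rewrite -!scalemxAl yA scalerA -exprD; split; first by exists z.
    by exists (y *m B).
  exists (row_mx (p ^+ r *: y) z *m G); split.
    rewrite scalemxAl scale_row_mx scalerA -exprD -xA -xB -mul_mx_row.
    by rewrite -mulmxA ABG mulmx1.
  exists y; have := congr1 (mulmx (row_mx (p ^+ r *: y) z)) GAB.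
  rewrite mulmx1 mulmxA mul_mx_row => /eq_row_mx[-> _].
  by [].
have PhiB x y : Phi (x - y) = Phi x - Phi y.
  by rewrite PhiD -[- y]scaleN1r PhiZ scaleN1r.
pose phi (x : quotmod L) := Phi (repr x).
have phi_pi x : phi (\pi_(quotmod L)%qT x) = Phi x.
  apply/subr0_eq; rewrite -PhiB; apply/Phi0/quotmod_eqP.
  by rewrite reprK.
have phi_lin : linear phi.
  move=> a; elim/quotW=> x; elim/quotW=> y.
  by rewrite -quotmod_piZ -quotmod_piD !phi_pi PhiD PhiZ.
pose f : {linear quotmod L -> elementary_type p n m r0 r} :=
  HB.pack phi (GRing.isLinear.Build R _ _ *:%R phi phi_lin).
pose g (e : elementary_type p n m r0 r) : quotmod L := \pi_(quotmod L)%qT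
  (frow (row_mx (\row_j repr (e.1 j)) (\row_j repr (e.2 j)) *m G)).
have gK : cancel g phi.
  move=> e; rewrite /g phi_pi /Phi frowK.
  have := congr1 (mulmx (row_mx (\row_j repr (e.1 j)) (\row_j repr (e.2 j)))) GAB.
  rewrite mulmx1 mulmxA mul_mx_row => /eq_row_mx[-> ->].
  rewrite [RHS]surjective_pairing.
  by congr (_, _); apply/ffunP => j; rewrite ffunE mxE reprK.
have phi_inj : injective phi.
  elim/quotW=> x; elim/quotW=> y; rewrite !phi_pi => e.
  by apply/quotmod_eqP/Phi0; rewrite PhiB e subrr.
by exists f; exists g => // x; apply: phi_inj; rewrite gK.
Qed.

(** Expansion in base [p] with digits lifted from the residue field: [k] digit vectors represent
    every class modulo [p^k]. *)
Lemma finite_quotmod n k (L : submodClosed (free_mod R n)) :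
  (forall x, frow (p ^+ k *: x) \in L) -> finite_set [set: quotmod L].
Proof.
move=> pL; have [T [h hP]] : exists (T : finType) (h : T -> 'rV[R]_n),
    forall x, exists t u, x = h t + p ^+ k *: u.
  elim: k {pL} => [|k [T [h hP]]].
    by exists unit, (fun=> 0) => x; exists tt, x; rewrite add0r scale1r.
  exists (T * 'rV[F]_n)%type, (fun u => h u.1 + p ^+ k *: u.2^l) => x.
  have [t [u ->]] := hP x; exists (t, u^r) => /=.
  have [|v vE] := @rho_mx_ker _ _ (u - u^r^l).
    by rewrite map_mxB lift_mxK subrr.
  exists v; rewrite exprSr -scalerA -vE scalerBr -[RHS]addrA.
  by rewrite [X in _ = _ + X]addrC subrK.
have -> : [set: quotmod L] = (fun t => \pi_(quotmod L)%qT (frow (h t))) @` [set: T].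
  apply/seteqP; split=> // q _; have [t [u e]] := hP (rowf (repr q)).
  exists t => //; rewrite -[RHS]reprK; apply/esym/quotmod_eqP.
  rewrite -[repr q]rowfK e; have -> // : frow (h t + p ^+ k *: u) - frow (h t) =
    frow (p ^+ k *: u).
  by apply: (can_inj (@rowfK n)); rewrite rowfB !frowK addrAC subrr add0r.
exact/finite_image/finite_finset.
Qed.

Lemma scaled_lat_preim n m r0 r (A : 'M[R]_(n, m)) (L : submodClosed (free_mod R n)) :
  scaled_lat r0 r A L -> [set y | frow (p ^+ r0 *: y) \in L] = lat r A.
Proof.
move=> LA; apply/seteqP; split=> y /=.
  by move=> /LA[z []]; rewrite frowK => /scale_pI ->.
by move=> yA; apply/LA; exists y; rewrite frowK.
Qed.

Lemma scaled_lat_closed n m r0 r (A : 'M[R]_(n, m)) (L : submodClosed (free_mod R n)) :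
  scaled_lat r0 r A L ->
  {in L &, forall x y, x * y \in L} <->
  (forall x y, lat r A x -> lat r A y -> lat r A (p ^+ r0 *: rmul x y)).
Proof.
move=> LA; split=> [Lc x y xA yA|Ac x y /LA[u [xu uA]] /LA[v [yv vA]]].
  have [||z []] := (LA _).1 (Lc (frow (p ^+ r0 *: x)) (frow (p ^+ r0 *: y)) _ _).
  - by apply/LA; exists x; rewrite frowK.
  - by apply/LA; exists y; rewrite frowK.
  by rewrite rowfM !frowK rmulZl rmulZr => /scale_pI ->.
apply/LA; exists (p ^+ r0 *: rmul u v); split; last exact: Ac.
by rewrite rowfM xu yv rmulZl rmulZr.
Qed.

Lemma scaled_lat_exists n m r0 r (A : 'M[R]_(n, m)) :
  exists L : submodClosed (free_mod R n), scaled_lat r0 r A L.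
Proof.
pose P x := `[< exists y, rowf x = p ^+ r0 *: y /\ lat r A y >].
have Pcl : subsemimod_closed (P : {pred free_mod R n}).
  split; first split.
  - apply/asboolP; exists 0; split; last by apply: ker_lat; rewrite mul0mx.
    by rewrite scaler0; apply/rowP => i; rewrite !mxE ffunE.
  - move=> x y /asboolP[u [xu uA]] /asboolP[v [yv vA]]; apply/asboolP.
    by exists (u + v); rewrite rowfD xu yv scalerDr; split=> //; exact: latD.
  - move=> c x /asboolP[u [xu uA]]; apply/asboolP; exists (c *: u).
    by rewrite rowfZ xu !scalerA mulrC; split=> //; exact: lat_scale.
exists (mk_submod Pcl) => x; rewrite in_mk_submod.
by split=> [/asboolP|h] //; apply/asboolP.
Qed.

(** Division by [p^r0] maps the submodules bijectively to the lattices [M], and closure of [p^r0 M]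
    becomes the twisted condition on [M]. *)
Lemma has_card_sublattices n m r0 r k : (0 < r)%N -> (m <= n)%N ->
  has_card [set M : set 'rV[R]_n | is_lat m r M /\
      forall x y, M x -> M y -> M (p ^+ r0 *: rmul x y)] k ->
  h_count p n m r0 r = k.
Proof.
move=> r_gt0 mn hk; apply: ncard_has_card.
pose f (L : submodClosed (free_mod R n)) := [set y | frow (p ^+ r0 *: y) \in L].
apply: (has_card_preim (f := f)) hk.
- move=> L /= [[_ Lc] /(isomorphic_scaled_lat r_gt0 mn)[A [Al LA]]].
  rewrite /f (scaled_lat_preim LA); split; first by exists A.
  exact/(scaled_lat_closed LA).
- move=> _ [[A [Al ->]] Ac]; have [L LA] := scaled_lat_exists r0 r A.
  exists L; last exact: scaled_lat_preim.
  split; last exact: scaled_lat_isomorphic LA.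
  split; last exact/(scaled_lat_closed LA).
  apply: (@finite_quotmod _ (r0 + r)) => x; apply/LA; exists (p ^+ r *: x).
  by rewrite frowK exprD -scalerA; split=> //; exact: latZ.
- move=> L L' /set_mem[_ /(isomorphic_scaled_lat r_gt0 mn)[A [_ LA]]].
  move=> /set_mem[_ /(isomorphic_scaled_lat r_gt0 mn)[A' [_ LA']]].
  rewrite /f (scaled_lat_preim LA) (scaled_lat_preim LA') => e.
  apply: submodClosed_ext => x.
  by apply/idP/idP => [/LA|/LA']; rewrite ?e => h; [apply/LA'|apply/LA; rewrite e].
Qed.

End Lattices.

Theorem proposition3p4 (o : idomainType) (pi : o) (q n iota : nat)
    (ho : compact_dvr pi)
    (hq : ([set: quotmod (principal_ideal pi)] #= `I_q)%card)
    (hn : (2 <= n)%N) (hiota : (1 <= iota <= n - 1)%N) :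
  Xi pi n iota =
    varY / (1 - varX * varY * (q ^ (iota * (n - iota)))%:R) *
    (fps2C (gauss_binomial q n iota) * (varX / (1 - varX)) +
     fps2C (theta n iota) * (1 / (1 - varY))).
Proof.
have [dvr unif _] := ho.
have [F [rho [rho_surj rho_ker <-]]] := residue_field dvr unif hq.
have pi0 := uniformizer_neq0 dvr unif.
have rho_unit x : rho x != 0 -> x \is a GRing.unit.
  move=> rx; apply: (dvr_unit dvr unif); apply: contraNN rx => /principalP[b xb].
  by apply/eqP/rho_ker; exists b.
have iota_n : (iota <= n)%N by lia.
apply: fpsP => a; apply: fpsP => b.
have -> : (#|F| ^ (iota * (n - iota)))%:R =
    fps2C (#|F| ^ (iota * (n - iota)))%:R by rewrite /fps2C !fpsC_nat.
rewrite fps2_coefE; case: b => [//|b] /=.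
rewrite (has_card_sublattices pi0 rho_surj rho_ker rho_unit _ _
  (has_card_scaled_closed pi0 rho_surj rho_ker rho_unit a _ iota_n)) // ltnNge.
set K := count _ _; rewrite [in LHS]mulnC.
case: leqP => /= _; rewrite natrM natrX mulnC.
  rewrite thetaE; congr (_ * _).
  (* With [n + 1] points and [n - iota + 1] blocks, the excess of points over blocks is [iota], the
     degree of the symmetric polynomial. *)
  have e : n.+1 = (iota + (n - iota + 1))%N by lia.
  by rewrite /K -[(n - iota).+1]addn1 e partition_seqs_complete_sym.
by rewrite card_left_ker_gauss // mulrC.
Qed.
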